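(* Let $A$ be a trunc. For $a\in A^+$ and rational $r$, define $$\widehat{a}(r,\infty)=\begin{cases}(\bot,\,a\blacktriangleright r), & r\geq 0,\\ (\top,\top), & r<0.\end{cases}$$ Then $\widehat{a}$ extends to a unique element $\widehat{a}\in\mathcal{R}_0\mathcal{M}A$, and the map $a\mapsto\widehat{a}$, $a\in A^+$, extends to a unique truncation isomorphism $$\mu_A:A\rightarrow\widehat{A}=\{\widehat{a}:a\in A\}\leq\mathcal{R}_0\mathcal{M}A$$ (where $\widehat{a}$ denotes $\mu_A(a)$ for $a\in A$, and $\widehat{A}\leq\mathcal{R}_0\mathcal{M}A$ means that $\widehat{A}$ is a subtrunc).
   Context: All $\ell$-groups are divisible abelian lattice-ordered groups, and $A^+=\{a\in A:a\geq 0\}$. A trunc is an $\ell$-group $A$ with a unary operation $a\mapsto\overline{a}$ on $A^+$ such that for all $a,b\in A^+$: (T1) $a\wedge\overline{b}\leq\overline{a}\leq a$; (T2) $\overline{a}=0$ implies $a=0$; (T3) if $na=\overline{na}$ for all $n\in\mathbb{N}$ (positive integers) then $a=0$; (T4) $\bigcap_{n\in\mathbb{N}}(a\ominus n)^{\bot\bot}=0$. Here, for $a\in A^+$, $a\ominus r=a-r\,\overline{a/r}$ for rational $r>0$, and $a\ominus 0=a$; $B^\bot=\{x\in A:|x|\wedge|b|=0\text{ for all }b\in B\}$. Truncs are automatically archimedean. $\overline{A}=\{\overline{a}:a\in A^+\}$. A truncation morphism between truncs is an $\ell$-homomorphism $f$ with $f(\overline{a})=\overline{f(a)}$ for $a\geq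 0$; a truncation isomorphism is a bijective one. A subtrunc is a divisible $\ell$-subgroup closed under truncation of its positive elements. A truncation kernel of $A$ is the set of elements sent to $0$ by some truncation morphism from $A$ into a trunc. $\mathcal{K}A$ is the set of truncation kernels ordered by inclusion; it is a frame, with meet given by intersection and join of a family the truncation kernel generated by its union. $[B]$ denotes the smallest truncation kernel containing $B\subseteq A$. For $a\in A^+$ and rational $r\geq 0$, $a\blacktriangleright r=[a\ominus r]$ and $a\blacktriangleleft r=\bigvee_{0<s<r}(a\ominus s)^\bot$, $s$ rational, the join taken in $\mathcal{K}A$ (polars are truncation kernels). $2=\{\bot,\top\}$ is the two-element frame. A pointed frame is a frame $M$ with a designated frame map (point) $\ast_M:M\to 2$; a pointed frame morphism is a frame map commuting with the points. The spectrum of $A$ is the pointed frame $\mathcal{M}A=2_F\mathcal{K}A=\{(\varepsilon,K)\in 2\times\mathcal{K}A:\varepsilon=\top\Rightarrow K\in F\}$ (a subframe of the product frame), with point $(\varepsilon,K)\mapsto\varepsilon$, where $F$ is the filter on $\mathcal{K}A$ generated by the kernels $a\blacktriangleleft 1$, $a\in\overline{A}$. For a frame $L$, $\mathcal{R}L$ is the set of frame maps $\mathcal{O}\mathbb{R}\to L$ ($\mathcal{O}\mathbb{R}$ the topology of $\mathbb{R}$). It is an $\ell$-group under the standard operations: for $\diamond\in\{+,\vee,\wedge\}$, $(f\diamond g)(U)=\bigvee\{f(U_1)\wedge g(U_2):U_1\diamond U_2\subseteq U\}$; $(-f)(U)=f(-U)$; zero is the constant map $0$, where the constant map $r$ sends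 $U$ to $\top$ if $r\in U$ and to $\bot$ otherwise. It is a trunc with $\overline{f}=f\wedge 1$ for $f\geq 0$. For a pointed frame $M$, $\mathcal{R}_0M$ is the subtrunc $\{f\in\mathcal{R}M:\ast_M\circ f=0\}$, where $0:\mathcal{O}\mathbb{R}\to 2$ sends $U$ to $\top$ iff $0\in U$; equivalently it is the set of pointed frame morphisms $\mathcal{O}_0\mathbb{R}=(\mathcal{O}\mathbb{R},0)\to M$. *)

(* Defs.v *)
From HB Require Import structures.
From mathcomp Require Import all_boot all_order all_algebra.
From mathcomp Require Import all_classical all_reals all_analysis.

Set Implicit Arguments.
Unset Strict Implicit.
Unset Printing Implicit Defensive.

Import Order.TTheory GRing.Theory Num.Theory.
Import numFieldNormedType.Exports.

Local Open Scope classical_set_scope.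
Local Open Scope ring_scope.

(* The lattice operations are fields rather than an Order.Lattice instance,
   because the hierarchy has no join of Order.Lattice with the ordered
   Z-modules. *)
HB.mixin Record isLGroup A of Num.POrderedZmodule A := {
  lg_join : A -> A -> A;
  lg_meet : A -> A -> A;
  lg_joinP : forall x y z : A, (lg_join x y <= z) = (x <= z) && (y <= z);
  lg_meetP : forall x y z : A, (z <= lg_meet x y) = (z <= x) && (z <= y);
  lg_leD2l : forall z x y : A, x <= y -> z + x <= z + y;
  lg_divisible : forall (n : nat) (a : A), (0 < n)%N -> exists b : A, b *+ n = a
}.

#[short(type="lgroupType")]
HB.structure Definition LGroup := { A of Num.POrderedZmodule A & isLGroup A }.

Section LGroupTheory.
Variable A : lgroupType.

(* The rational multiple r a.  Since an l-group is torsion-free, the element b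
   below, which exists by divisibility, is unique. *)
Definition qscale (r : rat) (a : A) : A :=
  xget 0 [set b : A | b *~ denq r = a *~ numq r].

Lemma lg_joinxx (x : A) : lg_join x x = x.
Proof.
apply/le_anti; rewrite lg_joinP lexx /=.
by have /andP[] : (x <= lg_join x x) && (x <= lg_join x x) by rewrite -lg_joinP lexx.
Qed.

Lemma lg_meetxx (x : A) : lg_meet x x = x.
Proof.
apply/le_anti; rewrite lg_meetP lexx !andbT.
by have /andP[] : (lg_meet x x <= x) && (lg_meet x x <= x) by rewrite -lg_meetP lexx.
Qed.

Definition lg_abs (a : A) : A := lg_join a (- a).

Definition polar (B : set A) : set A :=
  [set x | forall b, B b -> lg_meet (lg_abs x) (lg_abs b) = 0].

Definition ominus_of (bar : A -> A) (a : A) (r : rat) : A :=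
  if r == 0 then a else a - qscale r (bar (qscale r^-1 a)).

End LGroupTheory.

(* The truncation is an operation on the positive cone only; it is represented
   by a total function whose values off the positive cone are never used. *)
HB.mixin Record isTrunc A of LGroup A := {
  trunc : A -> A;
  trunc_ge0 : forall a : A, 0 <= a -> 0 <= trunc a;
  trunc_T1 : forall a b : A, 0 <= a -> 0 <= b ->
    lg_meet a (trunc b) <= trunc a /\ trunc a <= a;
  trunc_T2 : forall a : A, 0 <= a -> trunc a = 0 -> a = 0;
  trunc_T3 : forall a : A, 0 <= a ->
    (forall n : nat, (0 < n)%N -> a *+ n = trunc (a *+ n)) -> a = 0;
  trunc_T4 : forall a : A, 0 <= a ->
    \bigcap_(n in [set n : nat | (0 < n)%N])
       polar (polar [set ominus_of trunc a n%:R]) = [set 0]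
}.

#[short(type="truncType")]
HB.structure Definition Trunc := { A of LGroup A & isTrunc A }.

Definition ominus (A : truncType) (a : A) (r : rat) : A := ominus_of trunc a r.

(* The operations of a trunc, without the axioms.  Morphisms and subtruncs are
   defined at this level so that they apply both to truncs and to the
   operations on frame maps introduced below. *)
Record truncOps (T : Type) := TruncOps {
  op_zero : T;
  op_add : T -> T -> T;
  op_opp : T -> T;
  op_join : T -> T -> T;
  op_meet : T -> T -> T;
  op_trunc : T -> T
}.

Definition op_nneg T (o : truncOps T) (x : T) : Prop :=
  op_meet o (op_zero o) x = op_zero o.

Definition trunc_ops (A : truncType) : truncOps A :=
  TruncOps 0 +%R -%R lg_join lg_meet trunc.

Definition truncation_morphism S T (o : truncOps S) (p : truncOps T)
    (f : S -> T) : Prop :=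
  [/\ f (op_zero o) = op_zero p /\ {morph f : x / op_opp o x >-> op_opp p x},
      {morph f : x y / op_add o x y >-> op_add p x y},
      {morph f : x y / op_join o x y >-> op_join p x y},
      {morph f : x y / op_meet o x y >-> op_meet p x y} &
      forall x, op_nneg o x -> f (op_trunc o x) = op_trunc p (f x)].

Definition subtrunc T (o : truncOps T) (S : set T) : Prop :=
  [/\ S (op_zero o) /\ (forall x, S x -> S (op_opp o x)),
      (forall x y, S x -> S y -> S (op_add o x y)),
      (forall x y, S x -> S y -> S (op_join o x y) /\ S (op_meet o x y)),
      (forall (n : nat) x, (0 < n)%N -> S x ->
         exists2 y, S y & iter n (op_add o y) (op_zero o) = x) &
      (forall x, S x -> op_nneg o x -> S (op_trunc o x))].

(* A frame is determined by its order: finite meets and arbitrary joins are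
   the greatest lower and least upper bounds.  The operations are therefore
   recovered from a partial order with bounds.  In a frame the default value
   \bot matters only for the join of the empty set, where it is correct, and
   the default value \top is never used. *)
Section Frames.
Variables (d : Order.disp_t) (L : tbPOrderType d).

Definition fjoin (S : set L) : L := supremum \bot%O S.
Definition fmeet (x y : L) : L := infimum \top%O [set x; y].

Definition is_filter (F : set L) : Prop :=
  [/\ F \top%O,
      (forall x y, F x -> (x <= y)%O -> F y) &
      (forall x y, F x -> F y -> F (fmeet x y))].

Definition generated_filter (G : set L) : set L :=
  [set x | forall F, is_filter F -> G `<=` F -> F x].

End Frames.

Definition frame_map d d' (L : tbPOrderType d) (M : tbPOrderType d')
    (f : L -> M) : Prop :=
  [/\ f \top%O = \top%O,
      {morph f : x y / fmeet x y >-> fmeet x y} &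
      forall S : set L, f (fjoin S) = fjoin (f @` S)].

Record opens (R : realType) := Opens {
  oset :> set R;
  osetP : open oset
}.

Section Opens.
Variable R : realType.

Lemma oset_inj : injective (@oset R).
Proof.
by case=> U oU [V oV] /= eUV; subst V; rewrite (Prop_irrelevance oU oV).
Qed.

HB.instance Definition _ := gen_eqMixin (opens R).
HB.instance Definition _ := gen_choiceMixin (opens R).

Definition opens_le (U V : opens R) : bool := `[< oset U `<=` oset V >].

Lemma opens_le_refl : reflexive opens_le.
Proof. by move=> U; apply/asboolP. Qed.

Lemma opens_le_anti : antisymmetric opens_le.
Proof.
by move=> U V /andP[/asboolP UV /asboolP VU]; apply/oset_inj/seteqP; split.
Qed.

Lemma opens_le_trans : transitive opens_le.
Proof.
by move=> V U W /asboolP UV /asboolP VW; apply/asboolP => x /UV /VW.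
Qed.

HB.instance Definition _ := Order.Le_isPOrder.Build (Order.Disp tt tt) (opens R)
  opens_le_refl opens_le_anti opens_le_trans.

Lemma opens0x (U : opens R) : (Opens open0 <= U)%O.
Proof. by apply/asboolP => x []. Qed.

Lemma opensx1 (U : opens R) : (U <= Opens openT)%O.
Proof. by apply/asboolP. Qed.

HB.instance Definition _ := Order.hasBottom.Build _ (opens R) opens0x.
HB.instance Definition _ := Order.hasTop.Build _ (opens R) opensx1.

Definition ray (r : rat) : opens R := Opens (@open_gt R (ratr r)).

Lemma open_negation (U : opens R) : open [set x : R | oset U (- x)].
Proof.
by apply: (@open_comp _ _ (-%R : R -> R) (oset U)); [move=> x _; exact: opp_continuous|exact: osetP].
Qed.

Definition opens_neg (U : opens R) : opens R := Opens (@open_negation U).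

End Opens.

Section RealValued.
Variables (R : realType) (d : Order.disp_t) (L : tbPOrderType d).

Definition rl_op (phi : R -> R -> R) (f g : opens R -> L) : opens R -> L :=
  fun U => fjoin [set z | exists U1 U2 : opens R,
    (forall x y, oset U1 x -> oset U2 y -> oset U (phi x y)) /\
    z = fmeet (f U1) (g U2)].

Definition rl_const (r : R) : opens R -> L :=
  fun U => if `[< oset U r >] then \top%O else \bot%O.

(* The operations of the trunc of frame maps from the opens of R to L, given by
   the same formulas on arbitrary functions; RL and R0 below are sets of such
   functions closed under them.  The truncation f /\ 1 is the one of the trunc
   for nonnegative f only. *)
Definition rl_ops : truncOps (opens R -> L) :=
  TruncOps (rl_const 0) (rl_op +%R) (fun f U => f (opens_neg U))
    (rl_op Num.max) (rl_op Num.min) (fun f => rl_op Num.min f (rl_const 1)).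

Definition RL : set (opens R -> L) := [set f | frame_map f].

(* For a pointed frame (L, pt): the frame maps sent by the point to the map
   "contains 0" from the opens of R to the two-element frame. *)
Definition R0 (pt : L -> bool) : set (opens R -> L) :=
  [set f | RL f /\ forall U : opens R, pt (f U) = `[< oset U 0 >]].

End RealValued.

Definition is_tkernel (A : truncType) (K : set A) : Prop :=
  exists (B : truncType) (f : A -> B),
    truncation_morphism (trunc_ops A) (trunc_ops B) f /\ K = [set a | f a = 0].

Record tkernel (A : truncType) := TKernel {
  kset :> set A;
  ksetP : is_tkernel kset
}.

Section Kernels.
Variable A : truncType.

Lemma kset_inj : injective (@kset A).
Proof.
by case=> K kK [J kJ] /= eKJ; subst J; rewrite (Prop_irrelevance kK kJ).
Qed.

HB.instance Definition _ := gen_eqMixin (tkernel A).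
HB.instance Definition _ := gen_choiceMixin (tkernel A).

Definition tkernel_le (K J : tkernel A) : bool := `[< kset K `<=` kset J >].

Lemma tkernel_le_refl : reflexive tkernel_le.
Proof. by move=> K; apply/asboolP. Qed.

Lemma tkernel_le_anti : antisymmetric tkernel_le.
Proof.
by move=> K J /andP[/asboolP KJ /asboolP JK]; apply/kset_inj/seteqP; split.
Qed.

Lemma tkernel_le_trans : transitive tkernel_le.
Proof.
by move=> J K H /asboolP KJ /asboolP JH; apply/asboolP => x /KJ /JH.
Qed.

HB.instance Definition _ := Order.Le_isPOrder.Build (Order.Disp tt tt) (tkernel A)
  tkernel_le_refl tkernel_le_anti tkernel_le_trans.

Lemma is_tkernel0 : is_tkernel [set 0 : A].
Proof. by exists A, id; split. Qed.

Lemma trunc0 : trunc (0 : A) = 0.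
Proof.
have [_ h] := trunc_T1 (0 : A) 0 (lexx 0) (lexx 0).
by apply/le_anti; rewrite h (trunc_ge0 (0 : A) (lexx 0)).
Qed.

Lemma is_tkernelT : is_tkernel [set: A].
Proof.
exists A, (fun=> 0); split; last by apply/seteqP; split.
split=> /=; first by split=> // x /=; rewrite oppr0.
- by move=> x y /=; rewrite addr0.
- by move=> x y /=; rewrite lg_joinxx.
- by move=> x y /=; rewrite lg_meetxx.
- by move=> x _ /=; rewrite trunc0.
Qed.

Lemma tkernel0x (K : tkernel A) : (TKernel is_tkernel0 <= K)%O.
Proof.
apply/asboolP => x /= ->; case: K => K [B [f [[[f0 _] _ _ _ _] /= ->]]].
exact: f0.
Qed.

Lemma tkernelx1 (K : tkernel A) : (K <= TKernel is_tkernelT)%O.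
Proof. by apply/asboolP. Qed.

HB.instance Definition _ := Order.hasBottom.Build _ (tkernel A) tkernel0x.
HB.instance Definition _ := Order.hasTop.Build _ (tkernel A) tkernelx1.

Definition kgen (B : set A) : tkernel A :=
  xget \bot%O [set K : tkernel A | B `<=` K /\
                 forall J : tkernel A, B `<=` J -> (K <= J)%O].

Definition above (a : A) (r : rat) : tkernel A := kgen [set ominus a r].

(* The join of the polars of a (-) s, 0 < s < r: it ranges over the kernels whose underlying set is the polar of
   a (-) s for some rational 0 < s < r. *)
Definition below (a : A) (r : rat) : tkernel A :=
  fjoin [set K : tkernel A | exists s : rat,
           [/\ 0 < s, s < r & kset K = polar [set ominus a s]]].

Definition specF : set (tkernel A) :=
  generated_filter [set K : tkernel A | exists b : A, 0 <= b /\ K = below (trunc b) 1].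

End Kernels.

Record spectrum (A : truncType) := Spectrum {
  spair :> bool * tkernel A;
  spairP : spair.1 -> specF spair.2
}.

Section Spectrum.
Variable A : truncType.

Lemma spair_inj : injective (@spair A).
Proof.
by case=> p hp [q hq] /= epq; subst q; rewrite (Prop_irrelevance hp hq).
Qed.

HB.instance Definition _ := gen_eqMixin (spectrum A).
HB.instance Definition _ := gen_choiceMixin (spectrum A).

Definition spectrum_le (p q : spectrum A) : bool :=
  (p.1 <= q.1)%O && (p.2 <= q.2)%O.

Lemma spectrum_le_refl : reflexive spectrum_le.
Proof. by move=> p; rewrite /spectrum_le !lexx. Qed.

Lemma spectrum_le_anti : antisymmetric spectrum_le.
Proof.
move=> p q /andP[/andP[p1 p2] /andP[q1 q2]]; apply/spair_inj.
rewrite [LHS]surjective_pairing [RHS]surjective_pairing.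
by congr pair; apply/le_anti; apply/andP.
Qed.

Lemma spectrum_le_trans : transitive spectrum_le.
Proof.
move=> q p r /andP[p1 p2] /andP[q1 q2].
by rewrite /spectrum_le (le_trans p1 q1) (le_trans p2 q2).
Qed.

HB.instance Definition _ := Order.Le_isPOrder.Build (Order.Disp tt tt) (spectrum A)
  spectrum_le_refl spectrum_le_anti spectrum_le_trans.

Lemma spec_botP : (false, \bot%O : tkernel A).1 -> specF (false, \bot%O : tkernel A).2.
Proof. by []. Qed.

Lemma spec_topP : (true, \top%O : tkernel A).1 -> specF (true, \top%O : tkernel A).2.
Proof. by move=> _ F [FT _ _] _. Qed.

Lemma spectrum0x (p : spectrum A) : (Spectrum spec_botP <= p)%O.
Proof. by apply/andP; split => //=; exact: le0x. Qed.

Lemma spectrumx1 (p : spectrum A) : (p <= Spectrum spec_topP)%O.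
Proof. by apply/andP; split => /=; exact: lex1. Qed.

HB.instance Definition _ := Order.hasBottom.Build _ (spectrum A) spectrum0x.
HB.instance Definition _ := Order.hasTop.Build _ (spectrum A) spectrumx1.

Definition spec_point (p : spectrum A) : bool := p.1.

End Spectrum.

Arguments spec_point : clear implicits.

Definition hat_rays (R : realType) (A : truncType) (a : A)
    (f : opens R -> spectrum A) : Prop :=
  forall r : rat,
    spair (f (ray R r)) = if 0 <= r then (false, above a r) else (true, \top%O).

(* Main.v *)
Require Import Defs.
From HB Require Import structures.
From mathcomp Require Import all_boot all_order all_algebra.
From mathcomp Require Import all_classical all_reals all_analysis.
From mathcomp Require Import ring lra.

Set Implicit Arguments.
Unset Strict Implicit.
Unset Printing Implicit Defensive.

Import Order.TTheory GRing.Theory Num.Theory.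
Import numFieldNormedType.Exports.

Local Open Scope classical_set_scope.
Local Open Scope ring_scope.

(** The idea is to treat the spectrum as if it had points.  A character of a trunc is
    a homomorphism to the real numbers, with truncation at 1, defined on a convex
    l-subgroup; the elements outside are infinite at it.  The spectrum need not be
    spatial, but it is so with respect to finitely many elements at a time: if x lies
    outside a truncation kernel K, then for every finite set of elements there is a
    character that vanishes on K, is finite on that set and on x, and is nonzero at x.
    This property characterizes truncation kernels (tkernel_spatial,
    spatial_tkernel).

    To obtain characters (character_sep), a maximal filter of positive elements
    yields a totally ordered quotient.  Axioms T2 and T3 make the truncation there
    the meet with a positive unit, axiom T4 makes prescribed elements bounded by
    multiples of the unit, and Hoelder's argument maps the bounded elements to the
    real line.  Conversely, a set with the separation property is the kernel of the
    quotient map, because an axiom of truncs that fails in the quotient fails for the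
    real values at some character.  It follows that kernels are closed under
    intersection and residuation, so that they form a frame.

    The frame map of a sends an open set U to the pair of the truth value of 0 in U
    and the kernel generated by the x supported where a takes values in U.  Say that
    a character avoids an element of the spectrum if it vanishes on its kernel, and,
    in the case of the zero character, if moreover the first component is false.  The
    inequality p <= q holds as soon as every character that avoids q, and is finite on
    some given elements, avoids p (spectrum_sep).  If v avoids the image of U, the
    value of a at v lies outside U (avoids_hat); and to bound a meet of two images it
    suffices to look at the values of the two elements at the characters that avoid
    the bound (hat_meet_le).  With these facts the preservation of joins and meets
    of open sets, of addition, of the lattice operations and of truncation are
    statements about continuous functions of real numbers, which need no compactness
    argument, and distinct elements have distinct frame maps because they differ at a
    character where both are finite.  A frame map is determined by its values on the
    right rays since left rays are approximated by complements of right rays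
    (rays_determine), and an element is the difference of its positive and negative
    parts; this gives both uniqueness claims. *)

(** * Lattice-ordered groups *)

Section LGroupLemmas.
Variable A : lgroupType.
Implicit Types x y z f g h p q : A.

Lemma lg_meet_lel x y : lg_meet x y <= x.
Proof. by have := lexx (lg_meet x y); rewrite lg_meetP => /andP[]. Qed.

Lemma lg_meet_ler x y : lg_meet x y <= y.
Proof. by have := lexx (lg_meet x y); rewrite lg_meetP => /andP[]. Qed.

Lemma lg_le_meet x y z : z <= x -> z <= y -> z <= lg_meet x y.
Proof. by rewrite lg_meetP => -> ->. Qed.

Lemma lg_join_lel x y : x <= lg_join x y.
Proof. by have := lexx (lg_join x y); rewrite lg_joinP => /andP[]. Qed.

Lemma lg_join_ler x y : y <= lg_join x y.
Proof. by have := lexx (lg_join x y); rewrite lg_joinP => /andP[]. Qed.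

Lemma lg_join_le x y z : x <= z -> y <= z -> lg_join x y <= z.
Proof. by rewrite lg_joinP => -> ->. Qed.

Lemma lg_meetC x y : lg_meet x y = lg_meet y x.
Proof. by apply/le_anti; rewrite !lg_meetP !lg_meet_lel !lg_meet_ler. Qed.

Lemma lg_joinC x y : lg_join x y = lg_join y x.
Proof. by apply/le_anti; rewrite !lg_joinP !lg_join_lel !lg_join_ler. Qed.

Lemma lg_meetA : associative (@lg_meet A).
Proof.
move=> x y z; apply/le_anti/andP; split.
  apply: lg_le_meet; first apply: lg_le_meet.
  - exact: lg_meet_lel.
  - exact: le_trans (lg_meet_ler _ _) (lg_meet_lel _ _).
  - exact: le_trans (lg_meet_ler _ _) (lg_meet_ler _ _).
apply: lg_le_meet; last apply: lg_le_meet.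
- exact: le_trans (lg_meet_lel _ _) (lg_meet_lel _ _).
- exact: le_trans (lg_meet_lel _ _) (lg_meet_ler _ _).
- exact: lg_meet_ler.
Qed.

Lemma lg_meet_mono x y x' y' :
  x <= x' -> y <= y' -> lg_meet x y <= lg_meet x' y'.
Proof.
move=> xx' yy'; apply: lg_le_meet.
  exact: le_trans (lg_meet_lel _ _) xx'.
exact: le_trans (lg_meet_ler _ _) yy'.
Qed.

Lemma lg_join_idr x y : x <= y -> lg_join x y = y.
Proof. by move=> xy; apply/le_anti; rewrite lg_join_le //= lg_join_ler. Qed.

Lemma lg_meet_idl x y : x <= y -> lg_meet x y = x.
Proof. by move=> xy; apply/le_anti; rewrite lg_meet_lel lg_le_meet. Qed.

Lemma lg_lerD2l z x y : x <= y -> z + x <= z + y.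
Proof. exact: lg_leD2l. Qed.

Lemma lg_lerD x y x' y' : x <= x' -> y <= y' -> x + y <= x' + y'.
Proof.
move=> xx' yy'; apply: le_trans (lg_lerD2l x' yy').
by rewrite [x + y]addrC [x' + y]addrC; exact: lg_lerD2l.
Qed.

Lemma lg_lerN x y : x <= y -> - y <= - x.
Proof. by move=> /(lg_lerD2l (- x - y)); rewrite subrK addrAC addNr add0r. Qed.

Lemma lg_subr_ge0 x y : (0 <= y - x) = (x <= y).
Proof.
apply/idP/idP => [/(lg_lerD2l x)|/(lg_lerD2l (- x))]; first by rewrite addr0 addrC subrK.
by rewrite addNr addrC.
Qed.

Lemma lg_joinDr x y z : lg_join x y + z = lg_join (x + z) (y + z).
Proof.
apply/le_anti/andP; split; last first.
  by apply: lg_join_le; apply: lg_lerD => //; rewrite ?lg_join_lel ?lg_join_ler.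
have : lg_join x y <= lg_join (x + z) (y + z) - z.
  apply: lg_join_le; rewrite -[X in X <= _](addrK z); apply: lg_lerD => //.
    exact: lg_join_lel.
  exact: lg_join_ler.
by move=> /(fun le => lg_lerD le (lexx z)); rewrite subrK.
Qed.

Lemma lg_oppr_join x y : - lg_join x y = lg_meet (- x) (- y).
Proof.
apply/le_anti/andP; split.
  by apply: lg_le_meet; apply: lg_lerN; rewrite ?lg_join_lel ?lg_join_ler.
rewrite -[X in X <= _]opprK; apply: lg_lerN; apply: lg_join_le.
  by rewrite -[X in X <= _]opprK; apply/lg_lerN/lg_meet_lel.
by rewrite -[X in X <= _]opprK; apply/lg_lerN/lg_meet_ler.
Qed.

Lemma lg_meetE x y : lg_meet x y = - lg_join (- x) (- y).
Proof. by rewrite lg_oppr_join !opprK. Qed.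

Lemma lg_meetDr x y z : lg_meet x y + z = lg_meet (x + z) (y + z).
Proof. by rewrite !lg_meetE !opprD -lg_joinDr opprD opprK. Qed.

Definition lg_pos x : A := lg_join x 0.

Lemma lg_pos_ge0 x : 0 <= lg_pos x. Proof. exact: lg_join_ler. Qed.

Lemma lg_le_pos x : x <= lg_pos x. Proof. exact: lg_join_lel. Qed.

Lemma lg_pos_id x : 0 <= x -> lg_pos x = x.
Proof. by move=> x0; rewrite /lg_pos lg_joinC lg_join_idr. Qed.

Lemma lg_pos_eq0 x : x <= 0 -> lg_pos x = 0.
Proof. exact: lg_join_idr. Qed.

Lemma lg_posN x : lg_pos (- x) = lg_pos x - x.
Proof. by rewrite /lg_pos lg_joinDr subrr sub0r lg_joinC. Qed.

Lemma lg_posBN x : lg_pos x - lg_pos (- x) = x.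
Proof.
by rewrite lg_posN opprB addrC subrK.
Qed.

Lemma lg_meet_pos_neg x : lg_meet (lg_pos x) (lg_pos (- x)) = 0.
Proof.
rewrite lg_posN [lg_pos x - x]addrC -{1}[lg_pos x]add0r -lg_meetDr.
have -> : lg_meet 0 (- x) = - lg_pos x by rewrite /lg_pos lg_oppr_join oppr0 lg_meetC.
by rewrite addNr.
Qed.

Lemma lg_posD_le x y : lg_pos (x + y) <= lg_pos x + lg_pos y.
Proof.
apply: lg_join_le; first by apply: lg_lerD; apply: lg_le_pos.
by rewrite -[0]addr0; apply: lg_lerD; apply: lg_pos_ge0.
Qed.

(** Hence the elements disjoint from x are closed under addition. *)
Lemma lg_meetD_le x y z : 0 <= x -> 0 <= y -> 0 <= z ->
  lg_meet x (y + z) <= lg_meet x y + lg_meet x z.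
Proof.
move=> x0 y0 z0; set t := lg_meet x _.
suff : t - lg_meet x y <= lg_meet x z.
  by move=> /(lg_lerD2l (lg_meet x y)); rewrite addrC subrK.
rewrite lg_meetE opprK addrC lg_joinDr.
have tx : t <= x by apply: lg_meet_lel.
have tyz : t <= y + z by apply: lg_meet_ler.
apply: lg_join_le.
  apply: (@le_trans _ _ 0); last by apply: lg_le_meet.
  by move: (lg_lerD2l (- x) tx); rewrite addNr.
apply: lg_le_meet.
  by rewrite -[x]add0r; apply: lg_lerD => //; move: (lg_lerN y0); rewrite oppr0.
by move: (lg_lerD2l (- y) tyz); rewrite addrA addNr add0r.
Qed.

Lemma lg_meet_ge0 x y : 0 <= x -> 0 <= y -> 0 <= lg_meet x y.
Proof. exact: lg_le_meet. Qed.

Lemma lg_le_abs x : x <= lg_abs x. Proof. exact: lg_join_lel. Qed.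

Lemma lg_leN_abs x : - x <= lg_abs x. Proof. exact: lg_join_ler. Qed.

(** Such a preorder is comparison modulo a prime convex l-subgroup: its quotient
    is a totally ordered group, and the quotient map preserves the lattice
    operations. *)
Record prime_preorder (T : A -> A -> Prop) : Prop := PrimePreorder {
  pp_le : forall x y, x <= y -> T x y;
  pp_trans : forall x y z, T x y -> T y z -> T x z;
  pp_total : forall x y, T x y \/ T y x;
  pp_addr : forall x y z, T x y -> T (x + z) (y + z);
  pp_join : forall x y, T x y -> T (lg_join x y) y
}.

(** The members of F are thought of as neighbourhoods of a point, on one of which
    the positive part of x - y vanishes.  The convex l-subgroup behind this
    preorder is the union of the polars of the members of F. *)
Definition locally_le (F : set A) x y : Prop :=
  exists2 f, F f & lg_meet f (lg_pos (x - y)) = 0.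

(** Totality is where maximality of the filter enters: x - y has disjoint positive
    and negative parts, and of two disjoint elements one vanishes locally. *)
Lemma locally_le_prime (F : set A) :
  F !=set0 -> (forall f, F f -> 0 <= f) ->
  (forall f h, F f -> F h -> F (lg_meet f h)) ->
  (forall p q, 0 <= p -> 0 <= q -> lg_meet p q = 0 ->
     exists2 f, F f & lg_meet f p = 0 \/ lg_meet f q = 0) ->
  prime_preorder (locally_le F).
Proof.
move=> [f0 Ff0] F0 FM Fmax; split.
- move=> x y xy; exists f0 => //; rewrite lg_pos_eq0; last first.
    by rewrite -[x - y]opprK opprB -oppr0; apply: lg_lerN; rewrite lg_subr_ge0.
  by rewrite lg_meetC lg_meet_idl ?F0.
- move=> x y z [f Ff fxy] [h Fh hyz]; exists (lg_meet f h); first exact: FM.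
  have fh0 : 0 <= lg_meet f h by apply: lg_meet_ge0; exact: F0.
  apply/le_anti/andP; split; last by apply: lg_meet_ge0 => //; exact: lg_pos_ge0.
  apply: (@le_trans _ _ (lg_meet (lg_meet f h) (lg_pos (x - y) + lg_pos (y - z)))).
    apply: lg_meet_mono => //; apply: le_trans (lg_posD_le _ _).
    by rewrite addrA subrK.
  apply: le_trans (lg_meetD_le _ _ _) _ => //; rewrite ?lg_pos_ge0 //.
  rewrite -[0]addr0; apply: lg_lerD.
    by rewrite -fxy; apply: lg_meet_mono => //; apply: lg_meet_lel.
  by rewrite -hyz; apply: lg_meet_mono => //; apply: lg_meet_ler.
- move=> x y; have [] := Fmax (lg_pos (x - y)) (lg_pos (y - x)).
  + exact: lg_pos_ge0.
  + exact: lg_pos_ge0.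
  + by rewrite -[y - x]opprB lg_meet_pos_neg.
  by move=> f Ff [fp|fq]; [left|right]; exists f.
- move=> x y z [f Ff fxy]; exists f => //.
  by rewrite opprD addrACA subrr addr0.
- move=> x y [f Ff fxy]; exists f => //.
  by rewrite lg_joinDr subrr -/(lg_pos _) lg_pos_id ?lg_pos_ge0.
Qed.

(** Zorn's lemma applies to the families F that stay nonzero when met with g.  If a
    positive p can not be added to a maximal such F, some member of F is disjoint
    from p. *)
Lemma maximal_filter g : 0 <= g -> g != 0 ->
  exists F : set A, [/\ F g, (forall f, F f -> 0 <= f),
    (forall f h, F f -> F h -> F (lg_meet f h)),
    (forall f, F f -> lg_meet f g != 0) &
    (forall p q, 0 <= p -> 0 <= q -> lg_meet p q = 0 ->
       exists2 f, F f & lg_meet f p = 0 \/ lg_meet f q = 0)].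
Proof.
move=> g0 gn0.
pose P (F : set A) := [/\ (forall f, F f -> 0 <= f),
  (forall f h, F f -> F h -> F (lg_meet f h)) & (forall f, F f -> lg_meet f g != 0)].
have [|F [[F0 FM Fn] Fmax]] := @Zorn_bigcup A P.
  move=> C CP Ctot; split.
  - by move=> f [X CX Xf]; have [h _ _] := CP _ CX; exact: h.
  - move=> f h [X CX Xf] [Y CY Yh].
    have [XY|YX] := Ctot _ _ CX CY.
      by exists Y => //; have [_ hM _] := CP _ CY; apply: hM => //; exact: XY.
    by exists X => //; have [_ hM _] := CP _ CX; apply: hM => //; exact: YX.
  - by move=> f [X CX Xf]; have [_ _ h] := CP _ CX; exact: h.
have Fin p : 0 <= p -> lg_meet p g != 0 ->
    (forall f, F f -> lg_meet (lg_meet f p) g != 0) -> F p.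
  move=> p0 pg pF; apply: contrapT => nFp.
  pose F' := F `|` [set p] `|` [set x | exists2 f, F f & x = lg_meet f p].
  apply: (Fmax F').
    by split=> [f Ff|/(_ p)]; [left; left|move=> /(_ (or_introl (or_intror erefl)))].
  split.
  - move=> f [[Ff|->]|[h Fh ->]] //; first exact: F0.
    by apply: lg_meet_ge0 => //; exact: F0.
  - move=> f h [[Ff|->]|[f' Ff ->]] [[Fh|->]|[h' Fh ->]].
    + by left; left; exact: FM.
    + by right; exists f.
    + by right; exists (lg_meet f h'); rewrite ?lg_meetA //; exact: FM.
    + by right; exists h; rewrite // lg_meetC.
    + by left; right; rewrite lg_meetxx.
    + by right; exists h' => //; rewrite lg_meetC -lg_meetA lg_meetxx.
    + right; exists (lg_meet f' h); first exact: FM.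
      by rewrite -!lg_meetA [lg_meet p h]lg_meetC.
    + by right; exists f' => //; rewrite -lg_meetA lg_meetxx.
    + right; exists (lg_meet f' h'); first exact: FM.
      by rewrite -!lg_meetA [lg_meet p (lg_meet _ _)]lg_meetC -!lg_meetA lg_meetxx.
  - by move=> f [[Ff|->]|[h Fh ->]] //; [exact: Fn|exact: pF].
have Fg : F g.
  by apply: Fin => //; rewrite ?lg_meetxx // => f Ff; rewrite -lg_meetA lg_meetxx; exact: Fn.
exists F; split => //.
have Fcase p : 0 <= p -> ~ F p -> exists2 f, F f & lg_meet f p = 0.
  move=> p0 nFp; apply: contrapT => hno; apply: nFp; apply: Fin => //.
    apply/eqP => pg; apply: hno; exists g => //; by rewrite lg_meetC.
  move=> f Ff; apply/eqP => fpg; apply: hno; exists (lg_meet f g); first exact: FM.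
  by rewrite -lg_meetA [lg_meet g p]lg_meetC lg_meetA.
move=> p q p0 q0 pq.
have [Fp|nFp] := pselect (F p); last by have [f Ff h] := Fcase _ p0 nFp; exists f => //; left.
have [Fq|nFq] := pselect (F q); last by have [f Ff h] := Fcase _ q0 nFq; exists f => //; right.
have := Fn _ (FM _ _ Fp Fq); rewrite pq lg_meet_idl // eqxx //.
Qed.

(** Inequalities between elements of an l-group can thus be checked in totally
    ordered quotients. *)
Lemma prime_preorder_ex g : 0 <= g -> g != 0 ->
  exists2 T, prime_preorder T & ~ T g 0.
Proof.
move=> g0 gn0; have [F [Fg F0 FM Fn Fmax]] := maximal_filter g0 gn0.
exists (locally_le F); first by apply: locally_le_prime => //; exists g.
move=> [f Ff]; rewrite subr0 lg_pos_id // => fg.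
by have := Fn _ Ff; rewrite fg eqxx.
Qed.

End LGroupLemmas.

(** * Characters *)

Lemma ler_natS_inv (R : realType) (x y : R) (k : nat) :
  (forall q : nat, x <= y + k%:R / q.+1%:R) -> x <= y.
Proof.
move=> xy; apply/ler_addgt0Pr => e e0.
have k0 : 0 <= k%:R / e by rewrite divr_ge0 // ltW.
have kq := archi_boundP k0; set q := Num.bound _ in kq.
apply: le_trans (xy q) _; rewrite lerD2l ler_pdivrMr // mulrC.
rewrite -ler_pdivrMr //; apply: le_trans (ltW kq) _.
by rewrite ler_nat.
Qed.

(** A real point of the trunc, where elements may also be infinite: on the domain,
    a convex l-subgroup, a character is a homomorphism to the reals truncated at
    1, and cval_trunc_inf is the law min (+oo) 1 = 1 for positive elements off the
    domain. *)
Record character (R : realType) (A : truncType) := Character {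
  cdom : set A;
  cval : A -> R;
  cdomB : forall x y, cdom x -> cdom y -> cdom (x - y);
  cvalB : forall x y, cdom x -> cdom y -> cval (x - y) = cval x - cval y;
  cdom_convex : forall x y, 0 <= x -> x <= y -> cdom y -> cdom x;
  cdom_div : forall n x, cdom (x *+ n.+1) -> cdom x;
  cdom_join : forall x y, cdom x -> cdom y -> cdom (lg_join x y);
  cval_join : forall x y, cdom x -> cdom y ->
    cval (lg_join x y) = Num.max (cval x) (cval y);
  cdom_trunc : forall x, 0 <= x -> cdom (trunc x);
  cval_trunc : forall x, 0 <= x -> cdom x ->
    cval (trunc x) = Num.min (cval x) 1;
  cval_trunc_inf : forall x, 0 <= x -> ~ cdom x -> cval (trunc x) = 1
}.

Section PrimePreorder.
Variables (A : lgroupType) (T : A -> A -> Prop).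
Hypothesis hT : prime_preorder T.
Implicit Types x y z : A.

Lemma pp_refl x : T x x. Proof. exact: pp_le. Qed.

Lemma pp_tr [y x z : A] : T x y -> T y z -> T x z. Proof. exact: pp_trans. Qed.

Lemma ppD x y x' y' : T x y -> T x' y' -> T (x + x') (y + y').
Proof.
move=> xy xy'; apply: pp_tr (pp_addr hT _ xy) _.
by rewrite ![y + _]addrC; apply: pp_addr.
Qed.

Lemma ppN x y : T x y -> T (- y) (- x).
Proof.
by move=> /(pp_addr hT (- x - y)); rewrite addrA subrr add0r addrCA subrr addr0.
Qed.

Lemma pp_mulrn n x y : T x y -> T (x *+ n) (y *+ n).
Proof.
move=> xy; elim: n => [|n IH]; first exact: pp_refl.
by rewrite !mulrS; exact: ppD.
Qed.

Lemma pp_mulrn_cancel n x y : T (x *+ n.+1) (y *+ n.+1) -> T x y.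
Proof.
move=> xy; have [//|yx] := pp_total hT x y.
have h : T (x *+ n + x) (x *+ n + y).
  apply: (pp_tr (y := y *+ n.+1)); first by rewrite -mulrSr.
  by rewrite mulrSr; apply: pp_addr => //; exact: pp_mulrn.
by have := pp_addr hT (- (x *+ n)) h; rewrite ![_ *+ _ + _]addrC !addrK.
Qed.

Lemma pp_meet x y : T x y -> T x (lg_meet x y).
Proof.
move=> /ppN/(pp_join hT)/ppN; rewrite opprK lg_oppr_join !opprK.
by rewrite lg_meetC.
Qed.

End PrimePreorder.

(** Hoelder's theorem: an element is placed among the reals by comparing its
    multiples with those of the unit u.  Elements not bounded by a multiple of u
    are to be infinite. *)
Section Hoelder.
Variables (R : realType) (A : lgroupType) (T : A -> A -> Prop).
Hypothesis hT : prime_preorder T.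
Variable u : A.
Hypothesis u0 : ~ T u 0.
Implicit Types b c : A.

Lemma unit_ge0 : T 0 u. Proof. by have [] := pp_total hT u 0. Qed.

Lemma unit_mulz_le0 (p : int) : T (u *~ p) 0 -> p <= 0.
Proof.
case: p => [[|n]|n] //= un; exfalso; apply: u0.
by apply: (pp_mulrn_cancel hT (n := n)); rewrite mul0rn.
Qed.

Lemma unit_mulz_le (p p' : int) : T (u *~ p) (u *~ p') -> p <= p'.
Proof.
move=> /(pp_addr hT (- (u *~ p'))); rewrite subrr -mulrzBr => /unit_mulz_le0.
by rewrite subr_le0.
Qed.

Lemma unit_mulz_mono (p p' : int) : p <= p' -> T (u *~ p) (u *~ p').
Proof.
rewrite -subr_ge0; case E : (p' - p) => [n|n] // _.
have /(pp_addr hT (u *~ p)) := pp_mulrn hT n unit_ge0.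
rewrite mul0rn add0r -[u *+ n]/(u *~ n) -E -mulrzDr subrK //.
Qed.

Definition unit_bounded b : Prop :=
  exists n : nat, T (- (u *+ n)) b /\ T b (u *+ n).

Lemma unit_bounded_weak n m b : (n <= m)%N ->
  T (- (u *+ n)) b /\ T b (u *+ n) -> T (- (u *+ m)) b /\ T b (u *+ m).
Proof.
move=> nm [h1 h2].
have unm : T (u *+ n) (u *+ m) by apply: (@unit_mulz_mono n m).
by split; [exact: (pp_tr hT (ppN hT unm) h1)|exact: (pp_tr hT h2 unm)].
Qed.

Lemma unit_boundedB b c : unit_bounded b -> unit_bounded c -> unit_bounded (b - c).
Proof.
move=> [n [n1 n2]] [m [m1 m2]]; exists (n + m)%N; rewrite mulrnDr; split.
  by rewrite opprD; apply: ppD => //; apply: ppN.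
by apply: ppD => //; rewrite -[u *+ m]opprK; apply: ppN.
Qed.

Lemma unit_bounded_between b c d :
  T b c -> T c d -> unit_bounded b -> unit_bounded d -> unit_bounded c.
Proof.
move=> bc cd [n /unit_bounded_weak nb] [m /unit_bounded_weak md].
have [nb1 _] := nb _ (leq_maxl n m); have [_ md2] := md _ (leq_maxr n m).
exists (maxn n m); split; first exact: (pp_tr hT nb1 bc).
exact: (pp_tr hT cd md2).
Qed.

Lemma unit_bounded0 : unit_bounded 0.
Proof. by exists 0%N; rewrite mulr0n oppr0; split; exact: pp_refl. Qed.

Lemma unit_bounded_div n b : unit_bounded (b *+ n.+1) -> unit_bounded b.
Proof.
move=> hb; have [b0|b0] := pp_total hT 0 b.
  apply: (unit_bounded_between b0 _ unit_bounded0 hb).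
  by rewrite mulrS -{1}[b]addr0; apply: ppD => //;
  [exact: pp_refl|rewrite -(mul0rn _ n); exact: pp_mulrn].
apply: (unit_bounded_between _ b0 hb unit_bounded0).
by rewrite mulrS -{3}[b]addr0; apply: ppD => //;
  [exact: pp_refl|rewrite -(mul0rn _ n); exact: pp_mulrn].
Qed.

Lemma unit_floor b (q : nat) : unit_bounded b ->
  exists p : int, T (u *~ p) (b *+ q) /\ T (b *+ q) (u *~ (p + 1)).
Proof.
move=> [N [N1 N2]]; pose M := (N * q)%N.
have lo : T (u *~ (- M%:Z)) (b *+ q).
  by rewrite mulrNz -pmulrn mulrnA -mulNrn; apply: pp_mulrn.
pose P (k : nat) := `[< T (b *+ q) (u *~ (k%:Z - M%:Z)) >].
have exP : exists k, P k.
  exists (M + M)%N; apply/asboolP; rewrite PoszD addrK -pmulrn mulrnA.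
  exact: pp_mulrn.
case: (ex_minnP exP) => -[|k] /asboolP hk kmin.
  exists (- M%:Z); split => //; apply: (pp_tr hT hk _).
  by apply: unit_mulz_mono; rewrite sub0r lerDl.
exists (k%:Z - M%:Z); split; last by rewrite addrAC -[_ + 1]/((k + 1)%N%:Z) addn1.
have [|kb] := pp_total hT (u *~ (k%:Z - M%:Z)) (b *+ q); first by [].
by have := kmin k; rewrite ltnn => /(_ (introT (asboolP _) kb)).
Qed.

(** Denominators are successors throughout, so that no side condition is needed. *)
Definition hoelder b : R :=
  sup [set r | exists p : int, exists2 q : nat,
         r = p%:~R / q.+1%:R & T (u *~ p) (b *+ q.+1)].

Lemma frac_le (p p' : int) (q q' : nat) b :
  T (u *~ p) (b *+ q.+1) -> T (b *+ q'.+1) (u *~ p') ->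
  p%:~R / q.+1%:R <= p'%:~R / q'.+1%:R :> R.
Proof.
move=> /(pp_mulrn hT q'.+1) h1 /(pp_mulrn hT q.+1) h2.
rewrite -mulrnA mulnC mulrnA in h2.
have := pp_tr hT h1 h2; rewrite ![u *~ _ *+ _]pmulrn -!mulrzA => /unit_mulz_le.
by rewrite ler_pdivrMr // mulrAC ler_pdivlMr // ![_.+1%:R]pmulrn -!intrM ler_int.
Qed.

Lemma hoelder_ge b (p : int) (q : nat) : unit_bounded b ->
  T (u *~ p) (b *+ q.+1) -> p%:~R / q.+1%:R <= hoelder b.
Proof.
move=> [N [_ bN]] pq; apply: ub_le_sup; last by exists p, q.
exists (N%:Z%:~R / 1%:R) => r [p' [q' -> pq']].
exact: (frac_le pq').
Qed.

Lemma hoelder_le b (p : int) (q : nat) : unit_bounded b ->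
  T (b *+ q.+1) (u *~ p) -> hoelder b <= p%:~R / q.+1%:R.
Proof.
move=> hb pq; apply: ge_sup.
  by have [p' [pq' _]] := unit_floor 1 hb; exists (p'%:~R / 1%:R), p', 0%N.
by move=> r [p' [q' -> pq']]; exact: (frac_le pq').
Qed.

(** Additivity of the Hoelder map follows from this approximation, since the
    integer bounds of two elements add up. *)
Lemma hoelder_floor b (q : nat) : unit_bounded b -> exists p : int,
  [/\ T (u *~ p) (b *+ q.+1), T (b *+ q.+1) (u *~ (p + 1)),
      p%:~R / q.+1%:R <= hoelder b & hoelder b <= p%:~R / q.+1%:R + 1 / q.+1%:R].
Proof.
move=> hb; have [p [p1 p2]] := unit_floor q.+1 hb; exists p; split => //.
  exact: hoelder_ge.
by have := hoelder_le hb p2; rewrite intrD mulrDl.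
Qed.

Lemma hoelder_mono b c : unit_bounded b -> unit_bounded c -> T b c ->
  hoelder b <= hoelder c.
Proof.
move=> hb hc bc; apply: (@ler_natS_inv _ _ _ 1) => q.
have [p [p1 _ _ p2]] := hoelder_floor q hb.
apply: le_trans p2 _; rewrite lerD2r; apply: hoelder_ge => //.
exact: (pp_tr hT p1 (pp_mulrn hT _ bc)).
Qed.

Lemma hoelderB b c : unit_bounded b -> unit_bounded c ->
  hoelder (b - c) = hoelder b - hoelder c.
Proof.
move=> hb hc; have hbc := unit_boundedB hb hc.
apply/le_anti/andP; split; apply: (@ler_natS_inv _ _ _ 2) => q;
  have [p [p1 p2 p3 p4]] := hoelder_floor q hb;
  have [s [s1 s2 s3 s4]] := hoelder_floor q hc.
- have : T ((b - c) *+ q.+1) (u *~ (p + 1 - s)).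
    by rewrite mulrzBr mulrnBl; apply: ppD => //; exact: ppN.
  move=> /(hoelder_le hbc); rewrite intrB intrD mulr1z.
  move: p3 p4 s3 s4; move: (q.+1%:R^-1) => i; lra.
- have : T (u *~ (p - (s + 1))) ((b - c) *+ q.+1).
    by rewrite mulrzBr mulrnBl; apply: ppD => //; exact: ppN.
  move=> /(hoelder_ge hbc); rewrite intrB intrD mulr1z.
  move: p3 p4 s3 s4; move: (q.+1%:R^-1) => i; lra.
Qed.

Lemma unit_bounded_unit : unit_bounded u.
Proof.
exists 1%N; split; last exact: pp_refl.
by apply: (pp_tr hT (ppN hT unit_ge0)); rewrite oppr0; exact: unit_ge0.
Qed.

Lemma hoelder_unit : hoelder u = 1.
Proof.
apply/le_anti/andP; split.
  have := @hoelder_le u 1 0 unit_bounded_unit (pp_refl hT _).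
  by rewrite divr1.
have := @hoelder_ge u 1 0 unit_bounded_unit (pp_refl hT _).
by rewrite divr1.
Qed.

Lemma unit_bounded_join b c :
  unit_bounded b -> unit_bounded c -> unit_bounded (lg_join b c).
Proof.
wlog bc : b c / T b c.
  move=> h hb hc; have [bc|cb] := pp_total hT b c; first exact: h.
  by rewrite lg_joinC; exact: h.
move=> hb hc; apply: (unit_bounded_between _ _ hc hc); last exact: pp_join.
by apply: pp_le => //; exact: lg_join_ler.
Qed.

Lemma hoelder_join b c : unit_bounded b -> unit_bounded c ->
  hoelder (lg_join b c) = Num.max (hoelder b) (hoelder c).
Proof.
wlog bc : b c / T b c.
  move=> h hb hc; have [bc|cb] := pp_total hT b c; first exact: h.
  by rewrite lg_joinC maxC; exact: h.
move=> hb hc; rewrite max_r ?hoelder_mono //.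
apply/le_anti/andP; split; apply: hoelder_mono => //; try exact: unit_bounded_join.
  exact: pp_join.
by apply: pp_le => //; exact: lg_join_ler.
Qed.

End Hoelder.

(** In a totally ordered quotient the truncation is either the identity or the
    meet with an element u.  In the second case, which the two hypotheses on u
    express, measuring against u gives a character. *)
Section CharacterOfPreorder.
Variables (R : realType) (A : truncType) (T : A -> A -> Prop).
Hypothesis hT : prime_preorder T.
Variable u : A.
Hypothesis u0 : ~ T u 0.
Hypothesis Tu_le : forall b, 0 <= b -> T (trunc b) u.
Hypothesis Tu_ge : forall b c, 0 <= b -> T c b -> T c u -> T c (trunc b).
Implicit Types b c : A.

Let bounded_trunc b : 0 <= b -> unit_bounded T u (trunc b).
Proof.
move=> b0; apply: (unit_bounded_between hT u0 _ (Tu_le b0)).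
- exact: pp_le (trunc_ge0 _ b0).
- exact: unit_bounded0.
- exact: unit_bounded_unit.
Qed.

Let hoelder_trunc b : 0 <= b -> unit_bounded T u b ->
  hoelder R T u (trunc b) = Num.min (hoelder R T u b) 1.
Proof.
move=> b0 hb; have ht := bounded_trunc b0.
rewrite -(hoelder_unit R hT u0); apply/le_anti/andP; split.
  have [_ tb] := trunc_T1 b b b0 b0.
  rewrite le_min; apply/andP; split; apply: hoelder_mono => //; first exact: pp_le.
    exact: unit_bounded_unit.
  exact: Tu_le.
rewrite ge_min; have [bu|ub] := pp_total hT b u; apply/orP; [left|right].
  by apply: hoelder_mono => //; apply: Tu_ge => //; exact: pp_refl.
apply: hoelder_mono => //; first exact: unit_bounded_unit.
by apply: Tu_ge => //; exact: pp_refl.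
Qed.

Let hoelder_trunc_inf b : 0 <= b -> ~ unit_bounded T u b ->
  hoelder R T u (trunc b) = 1.
Proof.
move=> b0 hb; have ht := bounded_trunc b0; have hu := unit_bounded_unit hT u0.
rewrite -(hoelder_unit R hT u0); apply/le_anti/andP; split.
  by apply: hoelder_mono => //; exact: Tu_le.
apply: hoelder_mono => //; apply: Tu_ge => //; last exact: pp_refl.
have [//|bu] := pp_total hT u b; case: hb.
by apply: (unit_bounded_between hT u0 (pp_le hT b0) bu) => //; exact: unit_bounded0.
Qed.

Definition preorder_character : character R A.
Proof.
apply: (@Character R A (unit_bounded T u) (hoelder R T u)).
- exact: unit_boundedB.
- exact: hoelderB.
- move=> x y x0 xy; apply: (unit_bounded_between hT u0 (pp_le hT x0) (pp_le hT xy)).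
  exact: unit_bounded0.
- exact: unit_bounded_div.
- exact: unit_bounded_join.
- exact: hoelder_join.
- exact: bounded_trunc.
- exact: hoelder_trunc.
- exact: hoelder_trunc_inf.
Defined.

End CharacterOfPreorder.

(** A multiple and the element itself have the same sign in every totally ordered
    quotient. *)
Lemma lg_mulrn_ge0 (A : lgroupType) n (x : A) : 0 <= x *+ n.+1 -> 0 <= x.
Proof.
move=> xn; have [p0|pn0] := eqVneq (lg_pos (- x)) 0.
  have := lg_lerN (lg_le_pos (- x)).
  by rewrite p0 opprK oppr0.
have [T hT nT] := prime_preorder_ex (lg_pos_ge0 (- x)) pn0.
case: nT; apply: (pp_join hT); rewrite -oppr0; apply: (ppN hT).
by apply: (pp_mulrn_cancel hT (n := n)); rewrite mul0rn; exact: pp_le.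
Qed.

Lemma lg_mulrn_nneg (A : lgroupType) n (x : A) : 0 <= x -> 0 <= x *+ n.
Proof. by move=> x0; elim: n => // n IH; rewrite mulrS -[0]addr0; exact: lg_lerD. Qed.

Lemma qscaleP (A : lgroupType) (r : rat) (a : A) :
  qscale r a *~ denq r = a *~ numq r.
Proof.
rewrite /qscale; set P := [set b : A | _]; suff : P (xget 0 P) by [].
apply: xgetPex; have := denq_gt0 r; rewrite /P; case: (denq r) => // n n0.
by have [b hb] := lg_divisible n (a *~ numq r) n0; exists b; rewrite -hb.
Qed.

Lemma qscale_ge0 (A : lgroupType) (r : rat) (a : A) :
  0 <= r -> 0 <= a -> 0 <= qscale r a.
Proof.
move=> r0 a0; have := qscaleP r a; rewrite -numq_ge0 in r0.
have := denq_gt0 r; case: (denq r) => -[|d] // _; case: (numq r) r0 => // n _ e.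
by apply: (@lg_mulrn_ge0 _ d); rewrite -pmulrn in e; rewrite e -pmulrn lg_mulrn_nneg.
Qed.

Lemma qscale_nat (A : lgroupType) (m : nat) (a : A) : qscale m%:R a = a *+ m.
Proof.
by have := qscaleP m%:R a; rewrite -[m%:R]/(m%:Z%:~R) numq_int denq_int.
Qed.

Lemma ominus_of_nat (A : lgroupType) (bar : A -> A) a (m : nat) : 0 <= a ->
  exists e, [/\ 0 <= e, e *+ m.+1 = a &
                ominus_of bar a m.+1%:R = a - bar e *+ m.+1].
Proof.
move=> a0; exists (qscale m.+1%:R^-1 a); split.
- by apply: qscale_ge0; rewrite // invr_ge0.
- have := qscaleP m.+1%:R^-1 a.
  have -> : numq m.+1%:R^-1 = 1.
    rewrite -[m.+1%:R]/(m.+1%:Z%:~R) -div1r -[X in numq (X / _)]/(1%:~R).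
    by rewrite coprimeq_num /= ?coprime1n // mulr1 gtr0_sg.
  by rewrite -[m.+1%:R]/(m.+1%:Z%:~R) denqVz.
- by rewrite /ominus_of pnatr_eq0 /= qscale_nat.
Qed.

Lemma lg_abs_id (A : lgroupType) (a : A) : 0 <= a -> lg_abs a = a.
Proof.
move=> a0; rewrite /lg_abs lg_joinC lg_join_idr //.
by apply: (@le_trans _ _ 0) => //; rewrite -oppr0; exact: lg_lerN.
Qed.

Lemma lg_abs_ge0 (A : lgroupType) (a : A) : 0 <= lg_abs a.
Proof.
apply: (@lg_mulrn_ge0 _ 1); rewrite mulr2n -(subrr a).
by apply: lg_lerD; [exact: lg_le_abs|exact: lg_leN_abs].
Qed.

Section TruncLemmas.
Variable A : truncType.
Implicit Types a b x : A.

Lemma trunc_le a : 0 <= a -> trunc a <= a.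
Proof. by move=> a0; have [] := trunc_T1 a a a0 a0. Qed.

Lemma meet_trunc_le a b : 0 <= a -> 0 <= b -> lg_meet a (trunc b) <= trunc a.
Proof. by move=> a0 b0; have [] := trunc_T1 a b a0 b0. Qed.

(** This is where the trunc axioms are spent.  By T3 some multiple n x exceeds its
    truncation u, so that u can serve as the unit of a quotient in which x stays
    larger than u / n; by T2 the truncation z of the difference is nonzero.  By T4
    applied to a + x some y disjoint from (a + x) - m, truncated below at 0, is not
    disjoint from z, and in a quotient where the meet of z and y survives, a + x is
    at most m u.  The convex l-subgroup is chosen accordingly. *)
Lemma character_sep_pos (R : realType) x a : 0 <= x -> x != 0 -> 0 <= a ->
  exists v : character R A, [/\ cdom v x, cdom v a & 0 < cval v x].
Proof.
move=> x0 xn0 a0.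
have [n xn] : exists n, x *+ n.+1 <> trunc (x *+ n.+1).
  apply: contrapT => h; move/eqP: xn0; apply; apply: trunc_T3 => // -[//|n] _.
  by apply: contrapT => xn; apply: h; exists n.
have xn0' := lg_mulrn_nneg n.+1 x0; set u := trunc (x *+ n.+1) in xn.
pose w := x *+ n.+1 - u.
have w0 : 0 <= w by rewrite lg_subr_ge0 trunc_le.
have z0 := trunc_ge0 w w0; set z := trunc w in z0.
have zn0 : z <> 0 by move=> /(trunc_T2 _ w0)/eqP; rewrite subr_eq0 => /eqP.
have b0 : 0 <= a + x by rewrite -[0]addr0; exact: lg_lerD.
have [m m0 nz] : exists2 m, (0 < m)%N &
    ~ polar (polar [set ominus_of trunc (a + x) m%:R]) z.
  apply: contrapT => h; apply: zn0; suff : [set 0] z by [].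
  by rewrite -(trunc_T4 _ b0) => m m0; apply: contrapT => hm; apply: h; exists m.
have [y ym] : exists2 y, polar [set ominus_of trunc (a + x) m%:R] y &
    lg_meet (lg_abs z) (lg_abs y) != 0.
  apply: contrapT => h; apply: nz => y hy; apply: contrapT => hn.
  by apply: h; exists y => //; exact/eqP.
move: ym => /(_ _ erefl) ym.
rewrite lg_abs_id //; set g := lg_meet _ _ => gn0.
have g0 : 0 <= g by apply: lg_meet_ge0 => //; exact: lg_abs_ge0.
have [T hT nTg] := prime_preorder_ex g0 gn0.
have nTz : ~ T z 0 by move=> Tz; exact: nTg (pp_tr hT (pp_le hT (lg_meet_lel _ _)) Tz).
have nTy : ~ T (lg_abs y) 0 by move=> Ty; exact: nTg (pp_tr hT (pp_le hT (lg_meet_ler _ _)) Ty).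
have nTxu : ~ T (x *+ n.+1) u.
  move=> /(pp_addr hT (- u)); rewrite subrr => Tw; apply: nTz.
  exact: (pp_tr hT (pp_le hT (trunc_le w0)) Tw).
have Tu_le b : 0 <= b -> T (trunc b) u.
  move=> b0'; have [xb|bx] := pp_total hT (x *+ n.+1) (trunc b).
    case: nTxu; apply: (pp_tr hT (pp_meet hT xb)); apply: pp_le => //.
    exact: meet_trunc_le.
  apply: (pp_tr hT (pp_meet hT bx)); apply: pp_le => //.
  by rewrite lg_meetC; exact: meet_trunc_le.
have Tu_ge b c : 0 <= b -> T c b -> T c u -> T c (trunc b).
  move=> b0' cb cu; have mb := pp_le hT (meet_trunc_le b0' xn0').
  have [bu|ub] := pp_total hT b u.
    exact: (pp_tr hT cb (pp_tr hT (pp_meet hT bu) mb)).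
  by apply: (pp_tr hT cu (pp_tr hT (pp_meet hT ub) _)); rewrite lg_meetC.
have u0 : ~ T u 0 by move=> Tu; apply: nTz; exact: (pp_tr hT (Tu_le _ w0) Tu).
have hb : unit_bounded T u (a + x).
  case: m m0 {nz} ym => // m _ ym.
  have [e [e0 _ em]] := ominus_of_nat trunc m b0; exists m.+1.
  split.
    apply: (fun e => pp_tr hT e (pp_le hT b0)); rewrite -oppr0; apply: (ppN hT).
    by rewrite -(mul0rn _ m.+1); apply: (pp_mulrn hT); exact: unit_ge0.
  apply: (pp_tr hT (y := trunc e *+ m.+1)); last exact: (pp_mulrn hT _ (Tu_le _ e0)).
  rewrite -[X in T _ X]add0r -[X in T X _](subrK (trunc e *+ m.+1)).
  apply: (pp_addr hT); rewrite -em; apply: (pp_tr hT (pp_le hT (lg_le_abs _))).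
  rewrite -ym; have [h|h] := pp_total hT (lg_abs y) (lg_abs (ominus_of trunc (a + x) m.+1%:R)).
    by case: nTy; rewrite -ym; exact: (pp_meet hT).
  by rewrite lg_meetC; exact: (pp_meet hT).
pose v := preorder_character R hT u0 Tu_le Tu_ge.
have hx : cdom v x.
  apply: (@cdom_convex _ _ v x (a + x) x0 _ hb).
  by rewrite -{1}[x]add0r; exact: lg_lerD.
exists v; split => //.
  apply: (@cdom_convex _ _ v a (a + x) a0 _ hb).
  by rewrite -{1}[a]addr0; exact: lg_lerD.
have Tux : T (u *~ 1) (x *+ n.+1) by have [] := pp_total hT u (x *+ n.+1).
apply: lt_le_trans (hoelder_ge R hT u0 hx Tux).
by rewrite divr_gt0.
Qed.

End TruncLemmas.

Section CharacterTheory.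
Variables (R : realType) (A : truncType) (v : character R A).
Implicit Types x y : A.

Lemma cdom0 : cdom v 0.
Proof. by rewrite -(Defs.trunc0 A); apply: cdom_trunc. Qed.

Lemma cval0 : cval v 0 = 0.
Proof. by have := cvalB cdom0 cdom0; rewrite !subr0 subrr. Qed.

Lemma cdomN x : cdom v x -> cdom v (- x).
Proof. by move=> hx; rewrite -sub0r; apply: cdomB => //; exact: cdom0. Qed.

Lemma cvalN x : cdom v x -> cval v (- x) = - cval v x.
Proof. by move=> hx; rewrite -sub0r cvalB ?cval0 ?sub0r //; exact: cdom0. Qed.

Lemma cdomD x y : cdom v x -> cdom v y -> cdom v (x + y).
Proof. by move=> hx /cdomN hy; rewrite -[y]opprK; exact: cdomB. Qed.

Lemma cvalD x y : cdom v x -> cdom v y -> cval v (x + y) = cval v x + cval v y.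
Proof.
move=> hx hy; rewrite -{1}[y]opprK cvalB //; last exact: cdomN.
by rewrite cvalN // opprK.
Qed.

Lemma cdom_meet x y : cdom v x -> cdom v y -> cdom v (lg_meet x y).
Proof.
by move=> /cdomN hx /cdomN hy; rewrite lg_meetE; apply/cdomN/cdom_join.
Qed.

Lemma cval_meet x y : cdom v x -> cdom v y ->
  cval v (lg_meet x y) = Num.min (cval v x) (cval v y).
Proof.
move=> hx hy; have := cdomN hx; have := cdomN hy => hy' hx'.
rewrite lg_meetE cvalN ?cval_join ?cvalN ?oppr_max ?opprK //; exact: cdom_join.
Qed.

Lemma cdom_pos x : cdom v x -> cdom v (lg_pos x).
Proof. by move=> hx; apply: cdom_join => //; exact: cdom0. Qed.

Lemma cval_pos x : cdom v x -> cval v (lg_pos x) = Num.max (cval v x) 0.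
Proof. by move=> hx; rewrite cval_join ?cval0 //; exact: cdom0. Qed.

Lemma cdom_absW x : cdom v x -> cdom v (lg_abs x).
Proof. by move=> hx; apply: cdom_join => //; exact: cdomN. Qed.

Lemma cval_abs x : cdom v x -> cval v (lg_abs x) = `|cval v x|.
Proof.
move=> hx; rewrite cval_join ?cvalN //; last exact: cdomN.
by case: ger0P => h; [rewrite max_l|rewrite max_r]; lra.
Qed.

Lemma cdom_abs x : cdom v (lg_abs x) <-> cdom v x.
Proof.
split; last exact: cdom_absW.
move=> hx; rewrite -(lg_posBN x); apply: cdomB.
  apply: (cdom_convex (lg_pos_ge0 x) _ hx).
  by apply: lg_join_le; [exact: lg_le_abs|exact: lg_abs_ge0].
apply: (cdom_convex (lg_pos_ge0 (- x)) _ hx).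
by apply: lg_join_le; [exact: lg_leN_abs|exact: lg_abs_ge0].
Qed.

Lemma cval_mono x y : cdom v x -> cdom v y -> x <= y -> cval v x <= cval v y.
Proof.
by move=> hx hy /lg_join_idr xy; rewrite -xy cval_join // le_max lexx.
Qed.

Lemma cval_ge0 x : cdom v x -> 0 <= x -> 0 <= cval v x.
Proof. by move=> hx x0; rewrite -cval0; apply: cval_mono => //; exact: cdom0. Qed.

Lemma cdom_mulrn n x : cdom v x -> cdom v (x *+ n).
Proof.
move=> hx; elim: n => [|n IH]; first exact: cdom0.
by rewrite mulrS; exact: cdomD.
Qed.

Lemma cval_mulrn n x : cdom v x -> cval v (x *+ n) = cval v x *+ n.
Proof.
move=> hx; elim: n => [|n IH]; first by rewrite !mulr0n cval0.
by rewrite !mulrS cvalD ?IH //; exact: cdom_mulrn.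
Qed.

Lemma cdom_mulrz (p : int) x : cdom v x -> cdom v (x *~ p).
Proof.
move=> hx; case: p => n; first by rewrite -pmulrn; exact: cdom_mulrn.
by rewrite NegzE mulrNz -pmulrn; apply/cdomN/cdom_mulrn.
Qed.

Lemma cval_mulrz (p : int) x : cdom v x -> cval v (x *~ p) = cval v x *~ p.
Proof.
move=> hx; case: p => n; first by rewrite -!pmulrn; exact: cval_mulrn.
by rewrite NegzE !mulrNz -!pmulrn cvalN ?cval_mulrn //; exact: cdom_mulrn.
Qed.

Lemma cdom_qscale r x : cdom v x -> cdom v (qscale r x).
Proof.
move=> /(cdom_mulrz (numq r)); rewrite -qscaleP; have := denq_gt0 r.
by case: (denq r) => -[|d] // _; rewrite -pmulrn; exact: cdom_div.
Qed.

Lemma cval_qscale r x : cdom v x -> cval v (qscale r x) = ratr r * cval v x.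
Proof.
move=> hx; have := cval_mulrz (denq r) (cdom_qscale r hx).
rewrite qscaleP cval_mulrz // -(mulrzr (cval v x)) -(mulrzr (cval v _)) => e.
have d0 : (denq r)%:~R != 0 :> R by rewrite intr_eq0 denq_neq0.
by apply: (mulIf d0); rewrite -e /ratr; field.
Qed.

Lemma cdom_ominus x r : 0 <= x -> 0 <= r -> cdom v x -> cdom v (ominus x r).
Proof.
move=> x0 r0 hx; rewrite /ominus /ominus_of; case: ifP => // _.
apply: cdomB => //; apply/cdom_qscale/cdom_trunc/qscale_ge0 => //.
by rewrite invr_ge0.
Qed.

Lemma cval_ominus x r : 0 <= x -> 0 <= r -> cdom v x ->
  cval v (ominus x r) = Num.max (cval v x - ratr r) 0.
Proof.
move=> x0 r0 hx; have vx0 := cval_ge0 hx x0; rewrite /ominus /ominus_of.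
have [->|rn0] := eqVneq r 0; first by rewrite rmorph0 subr0 max_l.
have y0 : 0 <= qscale r^-1 x by apply: qscale_ge0; rewrite ?invr_ge0.
have hy := cdom_qscale r^-1 hx; have ht := cdom_trunc v y0.
rewrite cvalB //; last exact: cdom_qscale.
rewrite cval_qscale // cval_trunc // cval_qscale // fmorphV.
have s0 : 0 < ratr r :> R by rewrite ltr0q lt_def rn0.
rewrite minr_pMr ?ltW // mulr1 mulrA divff ?gt_eqF // mul1r.
by case: (leP (cval v x)) => h; case: leP => h'; lra.
Qed.

Definition cker : set A := [set x | cdom v x /\ cval v x = 0].

Lemma cker0 : cker 0. Proof. by split; [exact: cdom0|exact: cval0]. Qed.

Lemma cker_abs x : cker (lg_abs x) <-> cker x.
Proof.
split=> -[hx vx].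
  have hx' := (cdom_abs x).1 hx; split => //.
  by apply/eqP; rewrite -normr_eq0 -cval_abs // vx.
by split; [exact: cdom_absW|rewrite cval_abs // vx normr0].
Qed.

Lemma cker_trunc x : 0 <= x -> cker (trunc x) -> cker x.
Proof.
move=> x0 [_ vt]; have [hx|nhx] := pselect (cdom v x).
  split => //; have := cval_ge0 hx x0; move: vt; rewrite cval_trunc //.
  by case: (leP (cval v x) 1) => h e e0; lra.
by move: vt; rewrite cval_trunc_inf // => /eqP; rewrite oner_eq0.
Qed.

(** The kernel of a character is prime, even for elements outside the domain:
    truncation makes their values finite and keeps them nonzero. *)
Lemma cker_prime x y : cker (lg_meet (lg_abs x) (lg_abs y)) -> cker x \/ cker y.
Proof.
have a0 := @lg_abs_ge0 A; move=> [hm vm].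
pose t (z : A) := trunc (lg_abs z).
have ht z : cdom v (t z) by exact: cdom_trunc.
have : Num.min (cval v (t x)) (cval v (t y)) <= 0.
  rewrite -cval_meet // -vm; apply: cval_mono => //; first exact: cdom_meet.
  by apply: lg_meet_mono; exact: trunc_le.
have tker z : cval v (t z) <= 0 -> cker z.
  move=> tz; apply/cker_abs/cker_trunc => //; split; first exact: cdom_trunc.
  by apply/le_anti; rewrite tz (cval_ge0 (ht z)) //; exact: trunc_ge0.
by rewrite ge_min => /orP[]/tker; [left|right].
Qed.

End CharacterTheory.

(** Finitely many prescribed elements can be kept in the domain because their
    absolute values are dominated by a single positive element. *)
Lemma character_sep (R : realType) (A : truncType) (x : A) (s : seq A) :
  x != 0 -> exists v : character R A,
    [/\ forall a, a \in s -> cdom v a, cdom v x & cval v x != 0].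
Proof.
move=> xn0; pose a := lg_abs x + \sum_(b <- s) lg_abs b.
have sum0 : 0 <= \sum_(b <- s) lg_abs b.
  apply: (big_ind (fun b : A => 0 <= b)) => // [b c b0 c0|b _]; last exact: lg_abs_ge0.
  by rewrite -[0]addr0; exact: lg_lerD.
have a0 : 0 <= a by rewrite -[0]addr0; apply: lg_lerD => //; exact: lg_abs_ge0.
have ax : lg_abs x <= a by rewrite -[lg_abs x]addr0; exact: lg_lerD.
have as_ b : b \in s -> lg_abs b <= a.
  move=> bs; rewrite -[lg_abs b]add0r; apply: lg_lerD; first exact: lg_abs_ge0.
  rewrite (perm_big _ (perm_to_rem bs)) big_cons -{1}[lg_abs b]addr0; apply: lg_lerD => //.
  apply: (big_ind (fun c : A => 0 <= c)) => // [c d c0 d0|c _]; last exact: lg_abs_ge0.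
  by rewrite -[0]addr0; exact: lg_lerD.
have [y [y0 yn0 hy]] : exists y, [/\ 0 <= y, y != 0 & forall v : character R A,
    cdom v x -> 0 < cval v y -> cval v x != 0].
  have [p0|pn0] := eqVneq (lg_pos x) 0; last first.
    exists (lg_pos x); split => //; first exact: lg_pos_ge0.
    by move=> v hx; rewrite cval_pos // lt_max ltxx orbF => h; rewrite gt_eqF.
  exists (lg_pos (- x)); split; first exact: lg_pos_ge0.
    by rewrite lg_posN p0 sub0r oppr_eq0.
  move=> v hx; have hx' := cdomN hx; rewrite cval_pos // cvalN // lt_max ltxx orbF.
  by rewrite oppr_gt0 => h; rewrite lt_eqF.
have [v [_ ha vy]] := character_sep_pos R y0 yn0 a0.
have hb b : lg_abs b <= a -> cdom v b.
  by move=> ba; apply/cdom_abs/(cdom_convex (lg_abs_ge0 b) ba).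
have hx := hb _ ax.
by exists v; split => //; [move=> b /as_/hb|exact: hy].
Qed.

(** * Truncation kernels *)

(** This is the semantic form of being a truncation kernel: an element outside K is
    detected by a character vanishing on K and finite on any prescribed elements.
    Since characters respect the operations, K is then a subgroup, and the quotient
    inherits the trunc axioms from the real numbers. *)
Definition spatial (R : realType) (A : truncType) (K : set A) : Prop :=
  forall x (s : seq A), ~ K x -> exists v : character R A,
    [/\ forall a, a \in s -> cdom v a, cdom v x, K `<=` cker v & cval v x != 0].

Lemma spatial_mem (R : realType) (A : truncType) (K : set A) (s : seq A) x :
  spatial R K ->
  (forall v : character R A, (forall a, a \in s -> cdom v a) -> cdom v x ->
     K `<=` cker v -> cval v x = 0) -> K x.
Proof.
move=> hK h; apply: contrapT => /(hK x s)[v [vs vx vK]].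
by rewrite (h v) // eqxx.
Qed.

Section Pullback.
Variables (R : realType) (A B : truncType) (f : A -> B).
Hypothesis hf : truncation_morphism (trunc_ops A) (trunc_ops B) f.
Variable v : character R B.

Let f0 : f 0 = 0. Proof. by have [[]] := hf. Qed.

Let fD : {morph f : x y / x + y}. Proof. by have [] := hf. Qed.

Let fJ : {morph f : x y / lg_join x y}. Proof. by have [] := hf. Qed.

Let fB x y : f (x - y) = f x - f y.
Proof. by have [[_ fN] _ _ _ _] := hf; rewrite fD [f (- y)]fN. Qed.

Let fn n x : f (x *+ n) = f x *+ n.
Proof. by elim: n => [|n IH]; rewrite ?mulr0n // !mulrS fD IH. Qed.

Let fmono x y : x <= y -> f x <= f y.
Proof. by move=> /lg_join_idr xy; rewrite -xy fJ; exact: lg_join_lel. Qed.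

Let fpos x : 0 <= x -> 0 <= f x. Proof. by move=> /fmono; rewrite f0. Qed.

Let fT x : 0 <= x -> f (trunc x) = trunc (f x).
Proof.
by have [_ _ _ _ ft] := hf; move=> x0; apply: ft; rewrite /op_nneg /= lg_meet_idl.
Qed.

Definition pullback_character : character R A.
Proof.
apply: (@Character R A [set x | cdom v (f x)] (fun x => cval v (f x))) => /=.
- by move=> x y hx hy; rewrite fB; exact: cdomB.
- by move=> x y hx hy; rewrite fB; exact: cvalB.
- by move=> x y /fpos x0 /fmono xy hy; exact: cdom_convex x0 xy hy.
- by move=> n x; rewrite fn; exact: cdom_div.
- by move=> x y hx hy; rewrite fJ; exact: cdom_join.
- by move=> x y hx hy; rewrite fJ; exact: cval_join.
- by move=> x x0; rewrite fT //; apply: cdom_trunc; exact: fpos.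
- by move=> x x0 hx; rewrite fT //; apply: cval_trunc => //; exact: fpos.
- by move=> x x0 hx; rewrite fT //; apply: cval_trunc_inf => //; exact: fpos.
Defined.

End Pullback.

Lemma tkernel_spatial (R : realType) (A : truncType) (K : set A) :
  is_tkernel K -> spatial R K.
Proof.
move=> [B [f [hf ->]]] x s /eqP fx.
have [v [vs vx vn]] := character_sep R (map f s) fx.
exists (pullback_character hf v); split => //.
  by move=> a as_; apply: vs; exact: map_f.
by move=> y /= fy; rewrite /cker /= fy; exact: cker0.
Qed.

(** * Quotients *)

(** The quotient by a spatial set is a trunc.  An axiom about finitely many
    elements modulo K is a statement about their values at the characters that
    vanish on K and are finite on these elements, where it is a fact about real
    numbers truncated at 1. *)
Section Quotient.
Variables (R : realType) (A : truncType) (K : set A).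
Hypothesis hK : spatial R K.
Implicit Types x y z a b : A.

Let on (v : character R A) (s : seq A) :=
  (forall a, a \in s -> cdom v a) /\ K `<=` cker v.

Let on1 v x s : on v (x :: s) -> cdom v x.
Proof. by move=> [h _]; apply: h; rewrite mem_head. Qed.

Let onS v x s : on v (x :: s) -> on v s.
Proof. by move=> [h hv]; split => // a as_; apply: h; rewrite inE as_ orbT. Qed.

Let onker v x s : on v s -> K x -> cker v x.
Proof. by move=> [_ h] /h. Qed.

Let memK s x :
  (forall v, on v s -> cdom v x -> cval v x = 0) -> K x.
Proof. by move=> h; apply: (spatial_mem (s := s) hK) => v vs hx vK; exact: h. Qed.

Definition quo_rel x y := `[< K (x - y) >].

Lemma spatial0 : K 0.
Proof. by apply: (memK (s := [::])) => v _ _; exact: cval0. Qed.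

Lemma spatialB x y : K x -> K y -> K (x - y).
Proof.
move=> Kx Ky; apply: (memK (s := [::])) => v vs _.
have [hx vx] := onker vs Kx; have [hy vy] := onker vs Ky.
by rewrite cvalB // vx vy subrr.
Qed.

Lemma quo_rel_refl : reflexive quo_rel.
Proof. by move=> x; apply/asboolP; rewrite subrr; exact: spatial0. Qed.

Lemma quo_rel_sym : symmetric quo_rel.
Proof.
by move=> x y; apply/idP/idP => /asboolP h; apply/asboolP;
  have := spatialB spatial0 h; rewrite sub0r opprB.
Qed.

Lemma quo_rel_trans : transitive quo_rel.
Proof.
move=> y x z /asboolP xy; rewrite quo_rel_sym => /asboolP zy; apply/asboolP.
by have := spatialB xy zy; rewrite opprB addrA subrK.
Qed.

Canonical quo_equiv := EquivRel quo_rel quo_rel_refl quo_rel_sym quo_rel_trans.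

Definition quo := {eq_quot quo_equiv}%qT.
HB.instance Definition _ : EqQuotient A quo_equiv quo := EqQuotient.on quo.
HB.instance Definition _ := Choice.on quo.

Definition proj (x : A) : quo := \pi_quo%qT x.

Lemma quo_ind (P : quo -> Prop) : (forall x, P (proj x)) -> forall X, P X.
Proof. by move=> h; apply: quotW. Qed.

Lemma proj_eq x y : proj x = proj y <-> K (x - y).
Proof.
split => [/eqP|h]; last by apply/eqmodP/asboolP.
by rewrite eqmodE => /asboolP.
Qed.

Lemma proj_repr x : K (repr (proj x) - x).
Proof. by apply/proj_eq; rewrite /proj reprK. Qed.

Let repr_val v s x : on v s -> cdom v x ->
  cdom v (repr (proj x)) /\ cval v (repr (proj x)) = cval v x.
Proof.
move=> vs hx; have [h1 h2] := onker vs (proj_repr x).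
rewrite -[repr _](subrK x); split; first exact: cdomD.
by rewrite cvalD // h2 add0r.
Qed.

Let proj_eqv s x y : (forall v, on v s ->
  [/\ cdom v x, cdom v y & cval v x = cval v y]) -> proj x = proj y.
Proof.
move=> h; apply/proj_eq/(memK (s := s)) => v vs _.
by have [hx hy e] := h v vs; rewrite cvalB // e subrr.
Qed.

Let val_proj v s x y : on v s -> cdom v x -> cdom v y -> proj x = proj y ->
  cval v x = cval v y.
Proof.
move=> vs hx hy /proj_eq/(onker vs)[_ /eqP].
by rewrite cvalB // subr_eq0 => /eqP.
Qed.

Let op0 : quo := proj 0.
Let opN (X : quo) : quo := proj (- repr X).
Let opD (X Y : quo) : quo := proj (repr X + repr Y).

Let opNE x : opN (proj x) = proj (- x).
Proof.
apply: (proj_eqv (s := [:: x])) => v vs; have hx := on1 vs.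
have [h e] := repr_val vs hx.
by split; [exact: cdomN|exact: cdomN|rewrite !cvalN ?e].
Qed.

Let opDE x y : opD (proj x) (proj y) = proj (x + y).
Proof.
apply: (proj_eqv (s := [:: x; y])) => v vs; have hx := on1 vs; have hy := on1 (onS vs).
have [h e] := repr_val vs hx; have [h' e'] := repr_val vs hy.
by split; [exact: cdomD|exact: cdomD|rewrite !cvalD ?e ?e'].
Qed.

Let addA : associative opD.
Proof.
by elim/quo_ind=> x; elim/quo_ind=> y; elim/quo_ind=> z; rewrite !opDE addrA.
Qed.

Let addC : commutative opD.
Proof. by elim/quo_ind=> x; elim/quo_ind=> y; rewrite !opDE addrC. Qed.

Let add0 : left_id op0 opD.
Proof. by elim/quo_ind=> x; rewrite opDE add0r. Qed.

Let addN : left_inverse op0 opN opD.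
Proof. by elim/quo_ind=> x; rewrite opNE opDE addNr. Qed.

HB.instance Definition _ := GRing.isZmodule.Build quo addA addC add0 addN.

Lemma proj0 : proj 0 = 0. Proof. by []. Qed.

Lemma projN x : proj (- x) = - proj x. Proof. by rewrite -opNE. Qed.

Lemma projD x y : proj (x + y) = proj x + proj y. Proof. by rewrite -opDE. Qed.

Lemma proj_mulrn x n : proj (x *+ n) = proj x *+ n.
Proof. by elim: n => [|n IH]; rewrite ?mulr0n // !mulrS projD IH. Qed.

Definition quo_le (X Y : quo) : bool := `[< K (lg_pos (repr X - repr Y)) >].

Let quo_leP s x y :
  (forall v, on v s -> [/\ cdom v x, cdom v y & cval v x <= cval v y]) ->
  quo_le (proj x) (proj y).
Proof.
move=> h; apply/asboolP/(memK (s := s)) => v vs _.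
have [hx hy xy] := h v vs.
have [h1 e1] := repr_val vs hx; have [h2 e2] := repr_val vs hy.
by rewrite cval_pos ?cvalB ?e1 ?e2 ?max_r ?subr_le0 //; exact: cdomB.
Qed.

Let val_le v s x y : on v s -> cdom v x -> cdom v y ->
  quo_le (proj x) (proj y) -> cval v x <= cval v y.
Proof.
move=> vs hx hy /asboolP/(onker vs)[_].
have [h1 e1] := repr_val vs hx; have [h2 e2] := repr_val vs hy.
rewrite cval_pos ?cvalB ?e1 ?e2 //; last exact: cdomB.
by rewrite -subr_le0 => <-; rewrite le_max lexx.
Qed.

Let le_refl_ : reflexive quo_le.
Proof.
elim/quo_ind=> x; apply: (quo_leP (s := [:: x])) => v vs.
by have hx := on1 vs; split.
Qed.

Let le_anti_ : antisymmetric quo_le.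
Proof.
elim/quo_ind=> x; elim/quo_ind=> y /andP[xy yx].
apply: (proj_eqv (s := [:: x; y])) => v vs; have hx := on1 vs; have hy := on1 (onS vs).
by split => //; apply/le_anti; rewrite !(val_le vs).
Qed.

Let le_trans_ : transitive quo_le.
Proof.
elim/quo_ind=> y; elim/quo_ind=> x; elim/quo_ind=> z xy yz.
apply: (quo_leP (s := [:: x; y; z])) => v vs.
have hx := on1 vs; have hy := on1 (onS vs); have hz := on1 (onS (onS vs)).
by split => //; apply: (@le_trans _ _ (cval v y)); exact: val_le vs _ _ _.
Qed.

HB.instance Definition _ := Order.Le_isPOrder.Build ring_display quo
  le_refl_ le_anti_ le_trans_.

Definition quo_join (X Y : quo) : quo := proj (lg_join (repr X) (repr Y)).
Definition quo_meet (X Y : quo) : quo := proj (lg_meet (repr X) (repr Y)).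

Let quo_joinE x y : quo_join (proj x) (proj y) = proj (lg_join x y).
Proof.
apply: (proj_eqv (s := [:: x; y])) => v vs; have hx := on1 vs; have hy := on1 (onS vs).
have [h e] := repr_val vs hx; have [h' e'] := repr_val vs hy.
by split; [exact: cdom_join|exact: cdom_join|rewrite !cval_join ?e ?e'].
Qed.

Let quo_meetE x y : quo_meet (proj x) (proj y) = proj (lg_meet x y).
Proof.
apply: (proj_eqv (s := [:: x; y])) => v vs; have hx := on1 vs; have hy := on1 (onS vs).
have [h e] := repr_val vs hx; have [h' e'] := repr_val vs hy.
by split; [exact: cdom_meet|exact: cdom_meet|rewrite !cval_meet ?e ?e'].
Qed.

Let quo_joinP (X Y Z : quo) : (quo_join X Y <= Z) = (X <= Z) && (Y <= Z).
Proof.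
elim/quo_ind: X => x; elim/quo_ind: Y => y; elim/quo_ind: Z => z.
rewrite quo_joinE; apply/idP/andP => [h|[h1 h2]].
  split; apply: (quo_leP (s := [:: x; y; z])) => v vs;
  have hx := on1 vs; have hy := on1 (onS vs); have hz := on1 (onS (onS vs));
  split => //; have := val_le vs (cdom_join hx hy) hz h;
  by rewrite cval_join // ge_max => /andP[].
apply: (quo_leP (s := [:: x; y; z])) => v vs.
have hx := on1 vs; have hy := on1 (onS vs); have hz := on1 (onS (onS vs)).
split => //; first exact: cdom_join.
by rewrite cval_join // ge_max !(val_le vs).
Qed.

Let quo_meetP (X Y Z : quo) : (Z <= quo_meet X Y) = (Z <= X) && (Z <= Y).
Proof.
elim/quo_ind: X => x; elim/quo_ind: Y => y; elim/quo_ind: Z => z.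
rewrite quo_meetE; apply/idP/andP => [h|[h1 h2]].
  split; apply: (quo_leP (s := [:: x; y; z])) => v vs;
  have hx := on1 vs; have hy := on1 (onS vs); have hz := on1 (onS (onS vs));
  split => //; have := val_le vs hz (cdom_meet hx hy) h;
  by rewrite cval_meet // le_min => /andP[].
apply: (quo_leP (s := [:: x; y; z])) => v vs.
have hx := on1 vs; have hy := on1 (onS vs); have hz := on1 (onS (onS vs)).
split => //; first exact: cdom_meet.
by rewrite cval_meet // le_min !(val_le vs).
Qed.

Let quo_leD2l (Z X Y : quo) : X <= Y -> Z + X <= Z + Y.
Proof.
elim/quo_ind: X => x; elim/quo_ind: Y => y; elim/quo_ind: Z => z xy.
rewrite -!projD; apply: (quo_leP (s := [:: x; y; z])) => v vs.
have hx := on1 vs; have hy := on1 (onS vs); have hz := on1 (onS (onS vs)).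
split; try exact: cdomD.
by rewrite !cvalD // lerD2l (val_le vs).
Qed.

Let quo_divisible (n : nat) (X : quo) : (0 < n)%N -> exists Y : quo, Y *+ n = X.
Proof.
move=> n0; elim/quo_ind: X => x; have [y yx] := lg_divisible n x n0.
by exists (proj y); rewrite -proj_mulrn yx.
Qed.

HB.instance Definition _ :=
  isLGroup.Build quo quo_joinP quo_meetP quo_leD2l quo_divisible.

Lemma proj_join x y : proj (lg_join x y) = lg_join (proj x) (proj y).
Proof. by rewrite -quo_joinE. Qed.

Lemma proj_meet x y : proj (lg_meet x y) = lg_meet (proj x) (proj y).
Proof. by rewrite -quo_meetE. Qed.

Lemma proj_abs x : proj (lg_abs x) = lg_abs (proj x).
Proof. by rewrite /lg_abs proj_join projN. Qed.

Definition quo_trunc (X : quo) : quo := proj (trunc (lg_pos (repr X))).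

Let trunc_val v s x : on v s -> cdom v x -> cdom v (trunc (lg_pos x)) /\
  cval v (trunc (lg_pos x)) = Num.min (Num.max (cval v x) 0) 1.
Proof.
move=> vs hx; split; first exact/cdom_trunc/lg_pos_ge0.
by rewrite cval_trunc ?cval_pos ?lg_pos_ge0 //; exact: cdom_pos.
Qed.

Let quo_truncE x : quo_trunc (proj x) = proj (trunc (lg_pos x)).
Proof.
apply: (proj_eqv (s := [:: x])) => v vs; have hx := on1 vs.
have [h e] := repr_val vs hx.
have [h1 e1] := trunc_val vs hx; have [h2 e2] := trunc_val vs h.
by split => //; rewrite e1 e2 e.
Qed.

Let val_ge0 v s x : on v s -> cdom v x -> 0 <= proj x -> 0 <= cval v x.
Proof. by move=> vs hx /(val_le vs (cdom0 v) hx); rewrite cval0. Qed.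

Let quo_ge0 x : 0 <= x -> 0 <= proj x.
Proof.
move=> x0; apply: (quo_leP (s := [:: x])) => v vs; have hx := on1 vs.
by split => //; [exact: cdom0|rewrite cval0 cval_ge0].
Qed.

Let quo_trunc_ge0 (X : quo) : 0 <= X -> 0 <= quo_trunc X.
Proof.
elim/quo_ind: X => x _; rewrite quo_truncE; apply/quo_ge0/trunc_ge0.
exact: lg_pos_ge0.
Qed.

Let quo_T1 (X Y : quo) : 0 <= X -> 0 <= Y ->
  lg_meet X (quo_trunc Y) <= quo_trunc X /\ quo_trunc X <= X.
Proof.
elim/quo_ind: X => x; elim/quo_ind: Y => y x0 y0; rewrite !quo_truncE -proj_meet.
split; apply: (quo_leP (s := [:: x; y])) => v vs;
  have hx := on1 vs; have hy := on1 (onS vs);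
  have := val_ge0 vs hx x0; have := val_ge0 vs hy y0;
  have [h1 e1] := trunc_val vs hx; have [h2 e2] := trunc_val vs hy => vy vx;
  split => //; rewrite ?cval_meet ?e1 ?e2 ?[Num.max _ _]max_l //.
- exact: cdom_meet.
- by rewrite le_min !ge_min !lexx !orbT.
- by rewrite ge_min lexx.
Qed.

Let quo_T2 (X : quo) : 0 <= X -> quo_trunc X = 0 -> X = 0.
Proof.
elim/quo_ind: X => x x0; rewrite quo_truncE => tx.
apply: (proj_eqv (s := [:: x])) => v vs; have hx := on1 vs.
split => //; first exact: cdom0.
have vx := val_ge0 vs hx x0; have [h1 e1] := trunc_val vs hx.
have := val_proj vs h1 (cdom0 v) tx; rewrite e1 max_l // cval0.
by case: (leP (cval v x) 1) => // h e; lra.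
Qed.

Let quo_T3 (X : quo) : 0 <= X ->
  (forall n : nat, (0 < n)%N -> X *+ n = quo_trunc (X *+ n)) -> X = 0.
Proof.
elim/quo_ind: X => x x0 xn.
apply: (proj_eqv (s := [:: x])) => v vs; have hx := on1 vs.
split => //; first exact: cdom0.
rewrite cval0; apply/le_anti; rewrite (val_ge0 vs) // andbT.
apply: (@ler_natS_inv _ _ _ 1) => n; rewrite add0r ler_pdivlMr //.
have hn := cdom_mulrn n.+1 hx.
have := xn n.+1 isT; rewrite -proj_mulrn quo_truncE.
have [h1 e1] := trunc_val vs hn.
move=> /(val_proj vs hn h1); rewrite e1 cval_mulrn // mulr_natr => ->.
by rewrite ge_min lexx orbT.
Qed.

Let quo_T4 (X : quo) : 0 <= X ->
  \bigcap_(n in [set n : nat | (0 < n)%N])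
     polar (polar [set ominus_of quo_trunc X n%:R]) = [set 0].
Proof.
elim/quo_ind: X => a a0; apply/seteqP; split; last first.
  move=> _ -> n _ Y _; rewrite /lg_abs oppr0 lg_joinxx lg_meet_idl //.
  exact: lg_abs_ge0.
elim/quo_ind=> x hx; apply/eqP; rewrite -proj0; apply/eqP.
apply: (proj_eqv (s := [:: a; x])) => v vs; have va := on1 vs; have vx := on1 (onS vs).
split => //; first exact: cdom0.
rewrite cval0; apply/eqP/negP => /negP vxn.
have absx := lg_abs_ge0 x.
pose t := trunc (lg_abs x); pose d := Num.min `|cval v x| 1.
have d0 : 0 < d by rewrite /d lt_min normr_gt0 vxn ltr01.
have [n nd] : exists n : nat, cval v a < d *+ n.+1.
  exists (Num.bound (cval v a / d)); have va0 := val_ge0 vs va a0.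
  have := archi_boundP (divr_ge0 va0 (ltW d0)).
  rewrite ltr_pdivrMr // mulrC mulr_natr => /lt_le_trans; apply.
  by rewrite ler_wpMn2l // ltW.
(* y is supported where a takes values smaller than n + 1. *)
pose y := lg_pos (t *+ n.+1 - a).
have vt (w : character R A) : cdom w t by exact: cdom_trunc.
have cy (w : character R A) : cdom w a -> cdom w y /\
    cval w y = Num.max (cval w t *+ n.+1 - cval w a) 0.
  move=> wa; have h := cdomB (cdom_mulrn n.+1 (vt w)) wa; split; first exact: cdom_pos.
  by rewrite cval_pos // cvalB ?cval_mulrn //; exact: cdom_mulrn.
have := hx n.+1 isT (proj y).
have [E] := ominus_of_nat quo_trunc n a0; elim/quo_ind: E => e [e0 ea ->].
rewrite quo_truncE -proj_mulrn -projN -projD => /(_ _)/wrap[].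
  move=> _ ->; rewrite -!proj_abs -proj_meet -proj0.
  apply: (proj_eqv (s := [:: a; x])) => w ws; have wa := on1 ws; have wx := on1 (onS ws).
  have [wen wea] : cdom w (e *+ n.+1) /\ cval w (e *+ n.+1) = cval w a.
    move/eqP: ea; rewrite -proj_mulrn => /eqP/proj_eq/(onker ws)[h1 h2].
    rewrite -[e *+ _](subrK a); split; first exact: cdomD.
    by rewrite cvalD // h2 add0r.
  have we := cdom_div wen; rewrite cval_mulrn // in wea.
  have [h1 e1] := trunc_val ws we; have we0 := val_ge0 ws we e0.
  have [h2 e2] := cy w wa.
  have h3 := cdomB wa (cdom_mulrn n.+1 h1).
  split; [exact: cdom_meet (cdom_absW h2) (cdom_absW h3)|exact: cdom0|].
  rewrite cval_meet ?cval_abs ?cval0; try exact: cdom_absW; try done.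
  rewrite e2 cvalB ?cval_mulrn ?e1 //; last exact: cdom_mulrn.
  rewrite (max_l we0) -wea.
  have t1 : cval w t <= 1 by rewrite cval_trunc ?ge_min ?lexx ?orbT //; exact: cdom_absW.
  have [h|h] := leP (cval w e) 1.
    by rewrite subrr normr0 min_r.
  by rewrite max_r ?normr0 ?min_l // -mulrnBl pmulrn_lle0 // subr_le0; lra.
rewrite -!proj_abs -proj_meet => xy.
have [h e'] := cy v va; have hm := cdom_meet (cdom_absW vx) (cdom_absW h).
have := val_proj vs hm (cdom0 v) xy.
rewrite cval_meet ?cval_abs ?cval0 //; try exact: cdom_absW.
have -> : cval v y = d *+ n.+1 - cval v a.
  by rewrite e' /t cval_trunc ?cval_abs ?max_l // ?subr_ge0 ?ltW //; exact: cdom_absW.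
apply/eqP; rewrite gt_eqF // lt_min !normr_gt0 vxn subr_eq0.
by rewrite gt_eqF.
Qed.

HB.instance Definition _ :=
  isTrunc.Build quo quo_trunc_ge0 quo_T1 quo_T2 quo_T3 quo_T4.

Lemma spatial_tkernel : is_tkernel K.
Proof.
exists (quo : truncType), proj; split; last first.
  apply/seteqP; split => x; rewrite /= -proj0.
    by move=> Kx; apply/proj_eq; rewrite subr0.
  by move=> /proj_eq; rewrite subr0.
split=> /=.
- by split => // x; exact: projN.
- exact: projD.
- exact: proj_join.
- exact: proj_meet.
- move=> x; rewrite /op_nneg /= => x0; rewrite -[RHS]/(quo_trunc (proj x)) quo_truncE lg_pos_id //.
  by rewrite -x0; exact: lg_meet_ler.
Qed.

End Quotient.

(** * Meets and joins in ordered sets *)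

Section Bounds.
Variables (d : Order.disp_t) (L : tbPOrderType d).
Implicit Types (S : set L) (x y z l : L).

Definition is_lub S l :=
  (forall s, S s -> (s <= l)%O) /\
  (forall u, (forall s, S s -> (s <= u)%O) -> (l <= u)%O).

Definition is_glb2 x y l :=
  [/\ (l <= x)%O, (l <= y)%O & forall z, (z <= x)%O -> (z <= y)%O -> (z <= l)%O].

Lemma fjoinE S l : is_lub S l -> fjoin S = l.
Proof.
move=> [ub least]; rewrite /fjoin /supremum; case: ifPn => [/eqP S0|_].
  by apply/le_anti; rewrite le0x least // S0.
have : supremums S (xget \bot%O (supremums S)).
  by apply: xgetPex; exists l; split => // u hu; apply: least => s /hu.
move=> [h1 h2]; apply/le_anti/andP; split; first by apply: h2 => s /ub.
by apply: least => s /h1.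
Qed.

Lemma fmeetE x y l : is_glb2 x y l -> fmeet x y = l.
Proof.
move=> [lx ly great]; rewrite /fmeet /infimum; case: ifPn => [/eqP e|_].
  have xin : [set x; y] x by left.
  by rewrite e in xin.
have : infimums [set x; y] (xget \top%O (infimums [set x; y])).
  apply: xgetPex; exists l; split; first by move=> _ [->|->].
  by move=> z hz; apply: great; apply: hz; [left|right].
move=> [h1 h2]; apply/le_anti/andP; split.
  by apply: great; apply: h1; [left|right].
by apply: h2 => _ [->|->].
Qed.

Hypothesis joins : forall S, exists l, is_lub S l.
Hypothesis meets : forall x y, exists l, is_glb2 x y l.

Lemma fjoin_ub S x : S x -> (x <= fjoin S)%O.
Proof. by have [l hl] := joins S; rewrite (fjoinE hl); case: hl => h _ /h. Qed.

Lemma fjoin_le S z : (forall x, S x -> (x <= z)%O) -> (fjoin S <= z)%O.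
Proof. by have [l hl] := joins S; rewrite (fjoinE hl); case: hl => _; exact. Qed.

Lemma fmeet_lel x y : (fmeet x y <= x)%O.
Proof. by have [l hl] := meets x y; rewrite (fmeetE hl); case: hl. Qed.

Lemma fmeet_ler x y : (fmeet x y <= y)%O.
Proof. by have [l hl] := meets x y; rewrite (fmeetE hl); case: hl. Qed.

Lemma le_fmeet x y z : (z <= x)%O -> (z <= y)%O -> (z <= fmeet x y)%O.
Proof. by have [l hl] := meets x y; rewrite (fmeetE hl); case: hl => _ _; exact. Qed.

End Bounds.

Section OpensBounds.
Variable R : realType.

Lemma opens_leP (U V : opens R) : (U <= V)%O <-> oset U `<=` oset V.
Proof. by split => [/asboolP|h]; [|apply/asboolP]. Qed.

Lemma opens_bigcup_open (S : set (opens R)) : open (\bigcup_(U in S) oset U).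
Proof. by apply: bigcup_open => U _; exact: osetP. Qed.

Definition opens_bigcup (S : set (opens R)) : opens R := Opens (@opens_bigcup_open S).

Definition opens_setI (U V : opens R) : opens R := Opens (openI (@osetP _ U) (@osetP _ V)).

Lemma opens_lub S : is_lub S (opens_bigcup S).
Proof.
split; first by move=> U SU; apply/opens_leP => x Ux; exists U.
by move=> V h; apply/opens_leP => x [U SU Ux]; have /opens_leP := h _ SU; exact.
Qed.

Lemma opens_glb U V : is_glb2 U V (opens_setI U V).
Proof.
split; try by apply/opens_leP => x [].
by move=> W /opens_leP h /opens_leP h'; apply/opens_leP => x Wx; split; [exact: h|exact: h'].
Qed.

Lemma opens_ball (U : opens R) (t : R) : oset U t ->
  exists2 e, 0 < e & forall z, `|z - t| < e -> oset U z.
Proof.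
move=> Ut; have : nbhs t (oset U) by apply: open_nbhs_nbhs; split => //; exact: osetP.
move=> /nbhs_ballP[e e0 h]; exists e => // z zt; apply: h.
by rewrite -ball_normE /= distrC.
Qed.

End OpensBounds.

(** * The frames of kernels and of the spectrum *)

Section KernelLattice.
Variables (R : realType) (A : truncType).
Implicit Types (K J : tkernel A) (B : set A) (v : character R A).

Lemma tkernel_leP K J : (K <= J)%O <-> kset K `<=` kset J.
Proof. by split => [/asboolP|h]; [|apply/asboolP]. Qed.

Lemma kspatial K : spatial R (kset K).
Proof. by apply: tkernel_spatial; exact: ksetP. Qed.

Lemma kgenP B : B `<=` kset (kgen B) /\
  forall J, B `<=` kset J -> (kgen B <= J)%O.
Proof.
rewrite /kgen; set P := [set K : tkernel A | _]; suff : P (xget \bot%O P) by [].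
apply: xgetPex.
have hI : spatial R [set x | forall J, B `<=` kset J -> kset J x].
  move=> x s /existsNP[J /not_implyP[BJ nJx]].
  have [v [vs vx vJ vn]] := kspatial (x := x) s nJx.
  by exists v; split => // y hy; apply: vJ; exact: hy.
exists (TKernel (spatial_tkernel hI)); split => [x Bx J|J BJ]; first exact.
by apply/tkernel_leP => x; exact.
Qed.

Lemma sub_kgen B : B `<=` kset (kgen B). Proof. by have [] := kgenP B. Qed.

Lemma kgen_le B J : B `<=` kset J -> (kgen B <= J)%O.
Proof. by have [_] := kgenP B; exact. Qed.

Lemma tkernel_lub (S : set (tkernel A)) : exists K, is_lub S K.
Proof.
exists (kgen (\bigcup_(K in S) kset K)); split.
  by move=> K SK; apply/tkernel_leP => x Kx; apply: sub_kgen; exists K.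
move=> J h; apply: kgen_le => x [K SK Kx].
by have /tkernel_leP := h _ SK; exact.
Qed.

Lemma spatialI K J : spatial R (kset K `&` kset J).
Proof.
move=> x s /not_andP[nK|nJ].
  have [v [vs vx vK vn]] := kspatial (x := x) s nK.
  by exists v; split => // y [/vK].
have [v [vs vx vJ vn]] := kspatial (x := x) s nJ.
by exists v; split => // y [_ /vJ].
Qed.

Definition tkernelI K J : tkernel A := TKernel (spatial_tkernel (@spatialI K J)).

Lemma tkernel_glb K J : is_glb2 K J (tkernelI K J).
Proof.
split; try by apply/tkernel_leP => x [].
move=> H /tkernel_leP h /tkernel_leP h'; apply/tkernel_leP => x Hx.
by split; [exact: h|exact: h'].
Qed.

Lemma cker_meetl v x t : cker v x -> cker v (lg_meet (lg_abs x) (lg_abs t)).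
Proof.
move=> /cker_abs[hx vx].
have m0 : 0 <= lg_meet (lg_abs x) (lg_abs t) by apply: lg_meet_ge0; exact: lg_abs_ge0.
have mx := lg_meet_lel (lg_abs x) (lg_abs t).
have hm := cdom_convex m0 mx hx; split => //.
by apply/le_anti; rewrite (cval_ge0 hm m0) andbT -vx cval_mono.
Qed.

Lemma kmeetl K x t : kset K x -> kset K (lg_meet (lg_abs x) (lg_abs t)).
Proof.
move=> Kx; apply: (spatial_mem (s := [::]) (@kspatial K)) => v _ _ vK.
by have [] := cker_meetl t (vK _ Kx).
Qed.

(** This is the Heyting implication from the kernel generated by B to J.  That it
    is again a kernel, because kernels of characters are prime, is the
    distributivity of finite meets over arbitrary joins. *)
Lemma residual_spatial J B :
  spatial R [set x | forall t, B t -> kset J (lg_meet (lg_abs x) (lg_abs t))].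
Proof.
move=> x s /existsNP[t /not_implyP[Bt nJ]].
have [v [vs vm vJ vn]] := kspatial (x := lg_meet (lg_abs x) (lg_abs t)) (t :: x :: s) nJ.
have vx : cdom v x by apply: vs; rewrite !inE eqxx orbT.
have nx : ~ cker v x by move=> /(@cker_meetl v x t)[_ e]; rewrite e eqxx in vn.
have nt : ~ cker v t.
  by rewrite lg_meetC in vn; move=> /(@cker_meetl v t x)[_ e]; rewrite e eqxx in vn.
exists v; split => //.
- by move=> a as_; apply: vs; rewrite !inE as_ !orbT.
- by move=> y /(_ _ Bt)/vJ/cker_prime[].
- by apply/eqP => e; apply: nx.
Qed.

Definition residual J B : tkernel A := TKernel (spatial_tkernel (@residual_spatial J B)).

Lemma kabs K x : kset K (lg_abs x) -> kset K x.
Proof.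
move=> Kx; apply: (spatial_mem (s := [::]) (@kspatial K)) => v _ _ vK.
by have /cker_abs[] := vK _ Kx.
Qed.

End KernelLattice.

Section SpectrumLattice.
Variables (R : realType) (A : truncType).
Implicit Types (p q r : spectrum A) (v : character R A).

Lemma bool_leE (b c : bool) : (b <= c)%O = (b ==> c). Proof. by case: b c => [] []. Qed.

Lemma spectrum_leP p q :
  (p <= q)%O <-> (p.1 -> q.1) /\ kset p.2 `<=` kset q.2.
Proof.
split => [/andP[]|[h1 /tkernel_leP h2]].
  by rewrite bool_leE => /implyP h1 /tkernel_leP h2.
by apply/andP; split => //; rewrite bool_leE; apply/implyP.
Qed.

Lemma specF_up (K J : tkernel A) : specF K -> (K <= J)%O -> specF J.
Proof.
move=> FK KJ F hF GF; have [_ up _] := hF.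
by apply: up KJ; exact: FK.
Qed.

Lemma specF_meet (K J : tkernel A) : specF K -> specF J -> specF (fmeet K J).
Proof.
move=> FK FJ F hF GF; have [_ _ hM] := hF.
by apply: hM; [exact: FK|exact: FJ].
Qed.

Lemma spectrum_lub (S : set (spectrum A)) : exists p, is_lub S p.
Proof.
have lub := @tkernel_lub R A.
pose e := `[< exists2 p, S p & p.1 >]; pose K := fjoin [set p.2 | p in S].
have FK : (e, K).1 -> specF (e, K).2.
  move=> /= /asboolP[p Sp p1]; apply: specF_up (spairP p1) _.
  by apply: (fjoin_ub lub); exists p.
exists (Spectrum FK); split.
  move=> p Sp; apply/andP; split => /=; last by apply: (fjoin_ub lub); exists p.
  by rewrite bool_leE; apply/implyP => p1; apply/asboolP; exists p.
move=> q h; apply/andP; split => /=.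
  rewrite bool_leE; apply/implyP => /asboolP[p /h/spectrum_leP[pq _]]; exact: pq.
by apply: (fjoin_le lub) => _ [p /h/andP[_ pq] <-].
Qed.

Lemma spectrum_glb p q : exists l, is_glb2 p q l /\
  l.1 = p.1 && q.1 /\ kset l.2 = kset p.2 `&` kset q.2.
Proof.
have gE := fmeetE (@tkernel_glb R A p.2 q.2).
have [g1 g2 g3] := tkernel_glb R p.2 q.2.
have FK : (p.1 && q.1, tkernelI R p.2 q.2).1 -> specF (p.1 && q.1, tkernelI R p.2 q.2).2.
  move=> /= /andP[p1 q1]; rewrite -gE; apply: specF_meet; exact: spairP.
exists (Spectrum FK); split => //; split.
- by apply/andP; split => //=; rewrite bool_leE; apply/implyP => /andP[].
- by apply/andP; split => //=; rewrite bool_leE; apply/implyP => /andP[].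
- move=> r /spectrum_leP[rp1 rp2] /spectrum_leP[rq1 rq2]; apply/spectrum_leP; split.
    by move=> r1 /=; rewrite rp1 // rq1.
  by move=> x rx; split; [exact: rp2|exact: rq2].
Qed.

Lemma spectrum_glbW p q : exists l, is_glb2 p q l.
Proof. by have [l []] := spectrum_glb p q; exists l. Qed.

Lemma fjoin_point (S : set (spectrum A)) :
  (fjoin S).1 -> exists2 p, S p & p.1.
Proof.
move=> S1; apply: contrapT => h.
have FT : (false, \top%O : tkernel A).1 -> specF (false, \top%O : tkernel A).2 by [].
have : (fjoin S <= Spectrum FT)%O.
  apply: (fjoin_le spectrum_lub) => p Sp; apply/spectrum_leP; split => // p1.
  by case: h; exists p.
by move=> /spectrum_leP[/(_ S1)].
Qed.

(** Characters serve as points at which an element of the spectrum is seen to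
    fail; the zero character plays the part of the designated point.  Avoiding is
    stronger than lying outside an open set in a space of points, since v must
    vanish on a whole truncation kernel, but by spectrum_sep it determines the
    order even when only the characters finite on given elements are used. *)
Definition avoids v p : Prop :=
  kset p.2 `<=` cker v /\ ((forall x, cker v x) -> p.1 = false).

Definition zero_character : character R A.
Proof.
apply: (@Character R A [set: A] (fun=> 0)) => //.
- by move=> *; rewrite subrr.
- by move=> *; rewrite maxxx.
- by move=> *; rewrite min_l // ler01.
- by move=> x _ [].
Defined.

Lemma zero_avoids p : p.1 = false <-> avoids zero_character p.
Proof.
split => [p1|[_ ->//]]; first by split => // x _.
Qed.

Lemma avoids_le v p q : (p <= q)%O -> avoids v q -> avoids v p.
Proof.
move=> /spectrum_leP[pq1 pq2] [vq1 vq2]; split; first by move=> x /pq2/vq1.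
by move=> /vq2 q1; apply/negbTE/negP => /pq1; rewrite q1.
Qed.

Lemma avoids_fmeet v p q : avoids v (fmeet p q) -> avoids v p \/ avoids v q.
Proof.
have [l [lm [l1 l2]]] := spectrum_glb p q; rewrite (fmeetE lm) => -[].
rewrite l1 l2 => vK ve.
have [v0|/existsNP[z nz]] := pselect (forall x, cker v x).
  have /negbT := ve v0; rewrite negb_and => /orP[/negbTE h|/negbTE h].
    by left; split.
  by right; split.
have triv (r : spectrum A) : kset r.2 `<=` cker v -> avoids v r.
  by move=> h; split => // v0; case: nz.
have [hp|/existsNP[x /not_implyP[px nx]]] := pselect (kset p.2 `<=` cker v).
  by left; exact: triv.
right; apply: triv => t qt; have [] := @cker_prime _ _ v x t => //.
apply: vK; split; first exact: (kmeetl R).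
by rewrite lg_meetC; exact: (kmeetl R).
Qed.

Lemma spectrum_sep p q (s : seq A) :
  (forall v, (forall a, a \in s -> cdom v a) -> avoids v q -> avoids v p) ->
  (p <= q)%O.
Proof.
move=> h; apply/spectrum_leP; split.
  move=> p1; apply: contraT => /negbTE/zero_avoids/h/zero_avoids; rewrite p1.
  by move=> /(_ (fun _ _ => I)).
move=> x px; apply: contrapT => /(@kspatial R A q.2 x s)[v [vs vx vq vn]].
have nx : ~ cker v x by move=> [_ e]; rewrite e eqxx in vn.
have [|vp _] := h v vs; first by split => // v0; case: nx.
exact/nx/vp.
Qed.

(** Distributivity of the spectrum in the form used for the complementary rays
    below; the first components of the pairs are treated apart from the kernels. *)
Lemma spectrum_compl_le p q r :
  fmeet p q = \bot%O -> fjoin [set q; r] = \top%O -> (p <= r)%O.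
Proof.
have lub := spectrum_lub.
have [l [lm [l1 l2]]] := spectrum_glb p q; rewrite (fmeetE lm) => lbot qr.
rewrite lbot /= in l1 l2.
have qr1 : q.1 \/ r.1.
  by have [|s [->|->] s1] := @fjoin_point [set q; r]; rewrite ?qr //; [left|right].
pose J := residual R r.2 (kset p.2).
have qJ : (q.2 <= J)%O.
  apply/tkernel_leP => x qx t pt.
  have : [set 0 : A] (lg_meet (lg_abs x) (lg_abs t)).
    rewrite l2; split; last exact: (kmeetl R).
    by rewrite lg_meetC; exact: (kmeetl R).
  move=> ->; exact: (spatial0 (@kspatial R A r.2)).
have rJ : (r.2 <= J)%O.
  by apply/tkernel_leP => x rx t _; exact: (kmeetl R).
have FJ : (true, J).1 -> specF (true, J).2.
  by move=> _ /=; have [/spairP/specF_up|/spairP/specF_up] := qr1; apply.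
have topJ : (\top%O <= Spectrum FJ)%O.
  rewrite -qr; apply: (fjoin_le lub) => _ [->|->]; apply/spectrum_leP; split => //.
    by move/tkernel_leP: qJ.
  by move/tkernel_leP: rJ.
apply/spectrum_leP; split.
  by move=> p1; case: qr1 => // q1; move: l1; rewrite p1 q1.
move=> x px; have /spectrum_leP[_ /(_ x I)/(_ _ px)] := topJ.
by rewrite lg_meetxx; exact: kabs.
Qed.

End SpectrumLattice.

(** * The frame map of an element *)

Lemma inv_lt_natS (R : realType) (e : R) : 0 < e -> exists n : nat, 1 / e < n.+1%:R.
Proof.
move=> e0; exists (Num.bound (1 / e)).
apply: lt_le_trans (archi_boundP _) _; first by rewrite divr_ge0 // ltW.
by rewrite ler_nat.
Qed.

Section Hat.
Variables (R : realType) (A : truncType).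
Implicit Types (a b x y : A) (U V : opens R) (v w : character R A).

Let lub := @spectrum_lub R A.
Let glb := @spectrum_glbW R A.
Let sub_kgen := @sub_kgen R A.
Let kgen_le := @kgen_le R A.

(** These elements generate the kernel that the frame map of a attaches to U; only
    the characters at which a is finite are consulted. *)
Definition supported a U : set A :=
  [set x | forall v, cdom v a -> ~ cker v x -> oset U (cval v a)].

(** If U contains the interval of radius 1 / (n + 1) about 0, an element disjoint
    from the excess over s < 1 of b = (n + 1) |a|, truncated at 1, is supported where
    b is less than 1. *)
Lemma supported_specF a U : oset U 0 -> specF (kgen (supported a U)).
Proof.
move=> U0; have [e e0 eU] := opens_ball U0; have [n ne] := inv_lt_natS e0.
pose b := lg_abs a *+ n.+1.
have b0 : 0 <= b by apply/lg_mulrn_nneg/lg_abs_ge0.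
move=> F hF GF; have [_ up _] := hF.
apply: up (GF _ (ex_intro _ b (conj b0 erefl))) _.
apply: (fjoin_le (@tkernel_lub R A)) => K [s [s0 s1 Ks]].
apply/tkernel_leP => y; rewrite Ks => /(_ _ erefl) ys; apply: sub_kgen => w wa ny.
have tb0 := trunc_ge0 b b0; have wt := cdom_trunc w b0.
have wb : cdom w b by apply/cdom_mulrn/cdom_absW.
have [//|] : cker w y \/ cker w (ominus (trunc b) s).
  by apply: cker_prime; rewrite ys; exact: cker0.
have wa' := cdom_absW wa.
move=> [_]; rewrite (cval_ominus tb0 (ltW s0) wt) (cval_trunc b0 wb) cval_mulrn // cval_abs //.
move=> h; apply: eU; rewrite subr0.
have s1' : ratr s < 1 :> R by rewrite -(rmorph1 (@ratr R)) ltr_rat.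
have /le_lt_trans /(_ s1') : Num.min (`|cval w a| *+ n.+1) 1 <= ratr s.
  by rewrite -subr_le0 -h le_max lexx.
rewrite gt_min ltxx orbF -mulr_natr => h1.
rewrite ltr_pdivrMr // mulrC in ne.
by have := lt_trans h1 ne; rewrite ltr_pM2r.
Qed.

Lemma hat_proof a U : (`[< oset U 0 >], kgen (supported a U)).1 ->
  specF (`[< oset U 0 >], kgen (supported a U)).2.
Proof. by move=> /asboolP; exact: supported_specF. Qed.

Definition hat a U : spectrum A := Spectrum (@hat_proof a U).

(** The element is the positive part of (b - p) - 2 (b - m), both differences
    truncated below at 0, where m is the midpoint of p and q: a tent over the
    interval between p and q. *)
Lemma tent_function b (p q : rat) : 0 <= b -> 0 <= p -> p < q ->
  exists y, forall w, cdom w b -> ~ cker w y <-> ratr p < cval w b < ratr q.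
Proof.
move=> b0 p0 pq; pose m := (p + q) / 2%:R.
have m0 : 0 <= m by rewrite divr_ge0 // addr_ge0 // (le_trans p0) ?ltW.
exists (lg_pos (ominus b p - ominus b m *+ 2)) => w wb.
have wp := cdom_ominus b0 p0 wb; have wm := cdom_ominus b0 m0 wb.
have wm2 := cdom_mulrn 2 wm; have wd := cdomB wp wm2.
rewrite /cker /= cval_pos // cvalB // cval_mulrn // !cval_ominus //.
have wy := cdom_pos wd.
have pq' : ratr p < ratr q :> R by rewrite ltr_rat.
have -> : ratr m = (ratr p + ratr q) / 2%:R :> R.
  by rewrite /m rmorphM /= rmorphD /= fmorphV rmorph_nat.
move: (ratr p) (ratr q) (cval w b) pq' => P Q B PQ; rewrite mulr2n.
have -> : (P < B < Q) = (0 < Num.max (B - P) 0 -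
    (Num.max (B - (P + Q) / 2%:R) 0 + Num.max (B - (P + Q) / 2%:R) 0)).
  by apply/andP/idP; case: (leP (B - P) 0); case: (leP (B - (P + Q) / 2%:R) 0); lra.
set z := _ - _; split => [h|h [_ e]].
  rewrite ltNge; apply/negP => z0; apply: h; split => //.
  by rewrite max_r.
by move: e; rewrite max_l ?ltW // => e; rewrite e ltxx in h.
Qed.

(** A Urysohn argument: if the value of a at v lies in U, some element supported
    where a takes values in U is nonzero at v. *)
Lemma avoids_hat a U v : cdom v a -> avoids v (hat a U) -> ~ oset U (cval v a).
Proof.
move=> va [vU ve] Ut; have [v0|/existsNP[x nx]] := pselect (forall x, cker v x).
  have /= := ve v0; have [_ e] := v0 a; rewrite e in Ut.
  by move=> /negbT/asboolP.
suff [y [ya ny]] : exists y, supported a U y /\ ~ cker v y.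
  by apply: ny; apply: vU; exact: sub_kgen.
have [e e0 eU] := opens_ball Ut.
have tent b : 0 <= b -> cdom v b -> 0 < cval v b -> exists y, ~ cker v y /\
    forall w, cdom w b -> ~ cker w y -> 0 < cval w b /\ `|cval w b - cval v b| < e.
  move=> b0 vb vb0.
  have : Num.max 0 (cval v b - e) < cval v b by rewrite gt_max vb0 ltrBlDr ltrDl.
  move=> /rat_in_itvoo[p]; rewrite in_itv /= gt_max => /andP[/andP[p0 pe] pv].
  have : cval v b < cval v b + e by rewrite ltrDl.
  move=> /rat_in_itvoo[q]; rewrite in_itv /= => /andP[vq qe].
  have [||y hy] := @tent_function b p q b0.
  + by rewrite ltr0q in p0; exact: ltW.
  + by rewrite -(ltr_rat R) (lt_trans pv).
  exists y; split; first by apply/hy => //; rewrite pv vq.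
  move=> w wb /(hy _ wb)/andP[h1 h2]; split; first exact: lt_trans h1.
  by rewrite ltr_norml; apply/andP; split; lra.
have [t0|t0|t0] := ltgtP (cval v a) 0.
- have va' := cdomN va; have vp := cdom_pos va'.
  have vE : cval v (lg_pos (- a)) = - cval v a.
    by rewrite cval_pos // cvalN // max_l // oppr_ge0 ltW.
  have [|y [ny hy]] := tent (lg_pos (- a)) (lg_pos_ge0 _) vp.
    by rewrite vE oppr_gt0.
  exists y; split => // w wa nw; apply: eU.
  have wa' := cdomN wa; have [] := hy w (cdom_pos wa') nw.
  rewrite vE cval_pos // cvalN // lt_max ltxx orbF => w0.
  by rewrite max_l ?ltW // -opprD normrN.
- have vp := cdom_pos va.
  have vE : cval v (lg_pos a) = cval v a by rewrite cval_pos // max_l // ltW.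
  have [|y [ny hy]] := tent (lg_pos a) (lg_pos_ge0 _) vp; first by rewrite vE.
  exists y; split => // w wa nw; apply: eU.
  have [] := hy w (cdom_pos wa) nw.
  by rewrite vE cval_pos // lt_max ltxx orbF => w0; rewrite max_l ?ltW.
- have [n ne] := inv_lt_natS e0.
  (* Near 0 the values of a alone do not provide an element that is nonzero at v;
     the truncation of x takes its place. *)
  have absx := lg_abs_ge0 x; have nt w : cdom w (trunc (lg_abs x)) by exact: cdom_trunc.
  have hw w : cdom w a -> cdom w (trunc (lg_abs x) - lg_abs a *+ n.+1) /\
      cval w (trunc (lg_abs x) - lg_abs a *+ n.+1) =
      cval w (trunc (lg_abs x)) - `|cval w a| *+ n.+1.
    move=> wa; have wn := cdom_mulrn n.+1 (cdom_absW wa); split; first exact: cdomB.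
    by rewrite cvalB // cval_mulrn ?cval_abs //; exact: cdom_absW.
  exists (lg_pos (trunc (lg_abs x) - lg_abs a *+ n.+1)); split.
    move=> w wa ny; apply: eU; rewrite t0 subr0 ltNge; apply/negP => we; apply: ny.
    have [wd wE] := hw w wa; split; first exact: cdom_pos.
    rewrite cval_pos // wE max_r // subr_le0.
    have wt1 : cval w (trunc (lg_abs x)) <= 1.
      have [wx|nwx] := pselect (cdom w (lg_abs x)).
        by rewrite cval_trunc // ge_min lexx orbT.
      by rewrite cval_trunc_inf.
    apply: le_trans wt1 _; rewrite -mulr_natr.
    rewrite ltr_pdivrMr // in ne; apply: le_trans (ltW ne) _.
    by rewrite mulrC ler_wpM2r.
  have [vd vE] := hw v va; move=> [_]; rewrite cval_pos // vE t0 normr0 mul0rn subr0.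
  have vt0 := cval_ge0 (nt v) (trunc_ge0 _ absx).
  rewrite max_l // => vt; apply/nx/cker_abs/(cker_trunc absx); split => //.
Qed.

(** By distributivity the meet is tested on the generators of both kernels, and
    for these, unlike for arbitrary members, nonvanishing at v locates the values
    of a and b.  Together with avoids_hat this reduces inequalities between the
    frame maps to real numbers. *)
Lemma hat_meet_le (s : seq A) a b U V (r : spectrum A) :
  (forall v, (forall c, c \in s -> cdom v c) -> cdom v a -> cdom v b ->
     avoids v r -> oset U (cval v a) ->
     ~ oset V (cval v b)) ->
  (fmeet (hat a U) (hat b V) <= r)%O.
Proof.
move=> h; have [l [lm [l1 l2]]] := spectrum_glb R (hat a U) (hat b V).
rewrite (fmeetE lm); apply/spectrum_leP; split.
  rewrite l1 /= => /andP[/asboolP U0 /asboolP V0]; apply: contraT => /negbTE/(@zero_avoids R) r1.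
  by case: (h (zero_character R A) (fun _ _ => I) I I r1 U0 V0).
have gen x t : supported a U x -> supported b V t ->
    kset r.2 (lg_meet (lg_abs x) (lg_abs t)).
  move=> xa tb; apply: (spatial_mem (s := a :: b :: s) (@kspatial R A r.2)) => v vs vm vr.
  have va : cdom v a by apply: vs; rewrite inE eqxx.
  have vb : cdom v b by apply: vs; rewrite !inE eqxx orbT.
  apply: contrapT => vn.
  have nx : ~ cker v x by move=> /(@cker_meetl R A v x t)[_].
  have nt : ~ cker v t by rewrite lg_meetC in vn; move=> /(@cker_meetl R A v t x)[_].
  have vs' c : c \in s -> cdom v c by move=> cs; apply: vs; rewrite !inE cs !orbT.
  apply: (h v vs' va vb _ (xa _ va nx) (tb _ vb nt)).
  by split => // v0; case: nx.
have hb : (kgen (supported b V) <= residual R r.2 (supported a U))%O.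
  by apply: kgen_le => t tb x xa; rewrite lg_meetC; exact: gen.
have ha : (kgen (supported a U) <= residual R r.2 (kset (kgen (supported b V))))%O.
  apply: kgen_le => x xa t tb; rewrite lg_meetC.
  by move/tkernel_leP: hb; apply.
rewrite l2 => x [xa xb]; apply: (@kabs R).
by move/tkernel_leP: ha => /(_ _ xa _ xb); rewrite lg_meetxx.
Qed.

Lemma hat_le (s : seq A) a U (r : spectrum A) :
  (forall v, (forall c, c \in s -> cdom v c) -> cdom v a -> avoids v r ->
     ~ oset U (cval v a)) ->
  (hat a U <= r)%O.
Proof.
move=> h; apply: le_trans (hat_meet_le (s := s) (a := a) (b := a) (U := U) (V := U) (r := r) _).
  exact: (le_fmeet glb).
by move=> v vs va _ vr _; exact: h.
Qed.

Lemma hat_mono a U V : (U <= V)%O -> (hat a U <= hat a V)%O.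
Proof.
by move=> /opens_leP UV; apply: (hat_le (s := [::])) => v _ va /(avoids_hat va) nV /UV.
Qed.

Lemma avoids_top v : ~ avoids v (\top%O : spectrum A).
Proof. by move=> [vK] /=; have v0 x : cker v x by [exact: vK]; move=> /(_ v0). Qed.

Lemma hat_frame_map a : frame_map (hat a).
Proof.
split.
- apply/le_anti; rewrite lex1 /=; apply: (@spectrum_sep R A _ _ [:: a]) => v vs.
  by move=> /(avoids_hat (vs _ (mem_head _ _))) /(_ I).
- move=> U V; rewrite (fmeetE (opens_glb U V)); apply/le_anti/andP; split.
    apply: (le_fmeet glb); apply: hat_mono; apply/opens_leP; first exact: subIsetl.
    exact: subIsetr.
  by apply: (hat_meet_le (s := [::])) => v _ va _ /(avoids_hat va) nUV Uv Vv; apply: nUV.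
- move=> S; rewrite (fjoinE (opens_lub S)); apply/le_anti/andP; split; last first.
    apply: (fjoin_le lub) => _ [U SU <-]; apply: hat_mono.
    by apply/opens_leP => x Ux; exists U.
  apply: (hat_le (s := [::])) => v _ va vj [U SU Uv]; apply: (avoids_hat va) Uv.
  by apply: avoids_le vj; apply: (fjoin_ub lub); exists U.
Qed.

Lemma hat_R0 a : R0 (spec_point A) (hat a).
Proof. by split => //; exact: hat_frame_map. Qed.

Lemma hat_on_rays a : 0 <= a -> hat_rays a (hat a).
Proof.
move=> a0 r; case: ifPn => [r0|].
  rewrite [LHS]surjective_pairing; congr pair.
    by apply/negbTE/asboolP => /=; rewrite ltrq0 ltNge r0.
  apply/le_anti/andP; split; apply: kgen_le => x /=.
    move=> xa; apply: (spatial_mem (s := [:: a]) (@kspatial R A _)) => v vs vx vK.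
    have va := vs _ (mem_head _ _); apply: contrapT => vn.
    have : oset (ray R r) (cval v a) by apply: xa => // -[].
    have [|_ /eqP] := vK (ominus a r); first exact: sub_kgen.
    rewrite cval_ominus // => /eqP h /=; rewrite -subr_gt0 => h'.
    by move: h; rewrite max_l ?ltW // => h; rewrite h ltxx in h'.
  move=> ->; apply: sub_kgen => v va nk /=; rewrite ltNge; apply/negP => h; apply: nk.
  by split; [exact: cdom_ominus|rewrite cval_ominus // max_r // subr_le0].
rewrite -ltNge => r0; rewrite [LHS]surjective_pairing; congr pair.
  by apply/asboolP => /=; rewrite ltrq0.
apply/le_anti; rewrite lex1 /=; apply/tkernel_leP => x _; apply: sub_kgen => v va _ /=.
by apply: lt_le_trans (cval_ge0 va a0); rewrite ltrq0.
Qed.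

Lemma hatN a U : hat (- a) U = hat a (opens_neg U).
Proof.
apply/le_anti/andP; split.
  apply: (hat_le (s := [::])) => v _ va' vr; have va : cdom v a by rewrite -[a]opprK; exact: cdomN.
  by rewrite cvalN // => Uv; apply: (avoids_hat va) vr Uv.
apply: (hat_le (s := [::])) => v _ va vr; have := avoids_hat (cdomN va) vr.
by rewrite cvalN.
Qed.

Lemma rl_op_le (phi : R -> R -> R) (f g : opens R -> spectrum A) U (p : spectrum A) :
  (forall U1 U2 : opens R, (forall x y : R, oset U1 x -> oset U2 y -> oset U (phi x y)) ->
     (fmeet (f U1) (g U2) <= p)%O) -> (rl_op phi f g U <= p)%O.
Proof. by move=> h; apply: (fjoin_le lub) => _ [U1 [U2 [hU ->]]]; exact: h. Qed.

Lemma rl_op_ub (phi : R -> R -> R) (f g : opens R -> spectrum A) U (U1 U2 : opens R) :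
  (forall x y : R, oset U1 x -> oset U2 y -> oset U (phi x y)) ->
  (fmeet (f U1) (g U2) <= rl_op phi f g U)%O.
Proof. by move=> h; apply: (fjoin_ub lub); exists U1, U2. Qed.

Definition ball_opens (t e : R) : opens R := Opens (@ball_open _ _ t e).

Definition lipschitz_op (phi : R -> R -> R) :=
  forall x y x' y' : R, `|phi x y - phi x' y'| <= `|x - x'| + `|y - y'|.

Lemma lipschitz_op_opens (phi : R -> R -> R) U (x y : R) : lipschitz_op phi -> oset U (phi x y) ->
  exists U1 U2 : opens R, [/\ oset U1 x, oset U2 y &
    forall x' y' : R, oset U1 x' -> oset U2 y' -> oset U (phi x' y')].
Proof.
move=> hphi /opens_ball[e e0 eU].
have e2 : 0 < e / 2 by rewrite divr_gt0.
have ballE t z : oset (ball_opens t (e / 2)) z = (`|z - t| < e / 2) :> Prop.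
  by rewrite /= -ball_normE /= distrC.
exists (ball_opens x (e / 2)), (ball_opens y (e / 2)).
rewrite !ballE !subrr !normr0; split => // x' y'; rewrite !ballE => hx hy.
by apply: eU; apply: le_lt_trans (hphi _ _ _ _) _; lra.
Qed.

(** Addition, join and meet of elements and of frame maps agree for the same reason:
    each is given by a continuous function of the values. *)
Lemma hat_op (phi : R -> R -> R) (op : A -> A -> A) a b :
  lipschitz_op phi ->
  (forall v x y, cdom v x -> cdom v y ->
     cdom v (op x y) /\ cval v (op x y) = phi (cval v x) (cval v y)) ->
  hat (op a b) = rl_op phi (hat a) (hat b).
Proof.
move=> hphi hop; apply/funext => U; apply/le_anti/andP; split.
  apply: (hat_le (s := [:: a; b])) => v vs _ vr.
  have va : cdom v a by apply: vs; rewrite inE eqxx.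
  have vb : cdom v b by apply: vs; rewrite !inE eqxx orbT.
  have [_ ->] := hop v a b va vb.
  move=> /(lipschitz_op_opens hphi)[U1 [U2 [h1 h2 hU]]].
  have := avoids_le (rl_op_ub (hat a) (hat b) hU) vr.
  by move=> /(avoids_fmeet (R := R))[/(avoids_hat va)|/(avoids_hat vb)].
apply: rl_op_le => U1 U2 hU; apply: (hat_meet_le (s := [::])) => v _ va vb vr h1 h2.
have [hab e] := hop v a b va vb; apply: (avoids_hat hab vr).
by rewrite e; exact: hU.
Qed.

Lemma lipschitzD : lipschitz_op +%R.
Proof.
move=> x y x' y'; rewrite opprD addrACA; exact: ler_normD.
Qed.

Lemma lipschitz_max : lipschitz_op Num.max.
Proof.
move=> x y x' y'; have := ler_norm (x - x'); have := ler_norm (y - y').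
have := ler_norm (- (x - x')); have := ler_norm (- (y - y')); rewrite !normrN.
move: (`|x - x'|) (`|y - y'|) => X Y h1 h2 h3 h4; rewrite ler_norml.
by apply/andP; split; case: (leP x y); case: (leP x' y'); lra.
Qed.

Lemma lipschitz_min : lipschitz_op Num.min.
Proof.
move=> x y x' y'; have := ler_norm (x - x'); have := ler_norm (y - y').
have := ler_norm (- (x - x')); have := ler_norm (- (y - y')); rewrite !normrN.
move: (`|x - x'|) (`|y - y'|) => X Y h1 h2 h3 h4; rewrite ler_norml.
by apply/andP; split; case: (leP x y); case: (leP x' y'); lra.
Qed.

Lemma hatD a b : hat (a + b) = rl_op +%R (hat a) (hat b).
Proof.
apply: (hat_op (op := +%R)); first exact: lipschitzD.
by move=> v x y vx vy; split; [exact: cdomD|exact: cvalD].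
Qed.

Lemma hat_join a b : hat (lg_join a b) = rl_op Num.max (hat a) (hat b).
Proof.
apply: (hat_op (op := @lg_join A)); first exact: lipschitz_max.
by move=> v x y vx vy; split; [exact: cdom_join|exact: cval_join].
Qed.

Lemma hat_meet a b : hat (lg_meet a b) = rl_op Num.min (hat a) (hat b).
Proof.
apply: (hat_op (op := @lg_meet A)); first exact: lipschitz_min.
by move=> v x y vx vy; split; [exact: cdom_meet|exact: cval_meet].
Qed.

Lemma hat_const0 : hat 0 = rl_const (spectrum A) 0.
Proof.
apply/funext => U; rewrite /rl_const; case: ifPn => [/asboolP U0|/asboolP nU0].
  apply/le_anti; rewrite lex1 /=; apply: (@spectrum_sep R A _ _ [::]) => v _.
  by move=> /(avoids_hat (cdom0 v)); rewrite cval0.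
apply/le_anti; rewrite le0x andbT; apply: (hat_le (s := [::])) => v _ v0 _.
by rewrite cval0.
Qed.

Lemma hat_trunc a : 0 <= a ->
  hat (trunc a) = rl_op Num.min (hat a) (rl_const (spectrum A) 1).
Proof.
move=> a0; apply/funext => U; apply/le_anti/andP; split.
  apply: (hat_le (s := [:: a])) => v vs _ vr.
  have va : cdom v a by apply: vs; rewrite mem_head.
  rewrite cval_trunc // => /(lipschitz_op_opens lipschitz_min)[U1 [U2 [h1 h2 hU]]].
  have := avoids_le (rl_op_ub (hat a) (rl_const (spectrum A) 1) hU) vr.
  move=> /(avoids_fmeet (R := R))[/(avoids_hat va) //|].
  by rewrite /rl_const asboolT // => /avoids_top.
apply: rl_op_le => U1 U2 hU; rewrite /rl_const; case: ifPn => [/asboolP h1|_]; last first.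
  exact: le_trans (fmeet_ler glb _ _) (le0x _).
apply: le_trans (fmeet_lel glb _ _) _; apply: (hat_le (s := [::])) => v _ va vr Ua.
by apply: (avoids_hat (cdom_trunc v a0) vr); rewrite cval_trunc //; exact: hU.
Qed.

(** Disjoint balls about different values of a and b at v would have frame images
    with zero meet if the two frame maps agreed, yet v avoids neither image. *)
Lemma hat_inj : injective hat.
Proof.
move=> a b ab; apply/eqP; rewrite -subr_eq0; apply: contraT => /(@character_sep R A _ [:: a; b]).
move=> [v [vs _]].
have va : cdom v a by apply: vs; rewrite inE eqxx.
have vb : cdom v b by apply: vs; rewrite !inE eqxx orbT.
rewrite cvalB // subr_eq0 => vab.
pose e := `|cval v a - cval v b| / 2.
have e0 : 0 < e by rewrite divr_gt0 // normr_gt0 subr_eq0.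
pose U := ball_opens (cval v a) e; pose V := ball_opens (cval v b) e.
have UV z : oset U z -> oset V z -> False.
  rewrite /= -ball_normE /= /e => h1 h2.
  have := ler_normB (cval v a - z) (cval v b - z); rewrite opprB addrA subrK; lra.
have vbot : avoids v (\bot%O : spectrum A).
  by split => // x /= ->; exact: cker0.
have : (fmeet (hat a U) (hat b V) <= \bot)%O.
  rewrite -ab; apply: (hat_meet_le (s := [::])) => w _ _ _ _; exact: UV.
move=> /avoids_le/(_ vbot)/(avoids_fmeet (R := R))[/(avoids_hat va)|/(avoids_hat vb)].
  by case; exact: ballxx.
by case; exact: ballxx.
Qed.

End Hat.

(** * Uniqueness *)

Section RaysDetermine.
Variables (R : realType) (A : truncType).
Implicit Types (f g : opens R -> spectrum A) (U V : opens R).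

Let lub := @spectrum_lub R A.
Let glb := @spectrum_glbW R A.

Definition left_ray (r : rat) : opens R := Opens (@open_lt R (ratr r)).

Lemma frame_map_mono f U V : frame_map f -> (U <= V)%O -> (f U <= f V)%O.
Proof.
move=> [_ fM _] /opens_leP UV.
have <- : fmeet U V = U.
  rewrite (fmeetE (opens_glb U V)); apply: oset_inj; apply/seteqP.
  by split => [x []|x Ux] //; split => //; exact: UV.
by rewrite fM; exact: (fmeet_ler glb).
Qed.

(** The values of a frame map on right rays control those on left rays, which are
    almost complementary. *)
Lemma frame_map_left_ray f g (s q : rat) : frame_map f -> frame_map g ->
  (forall r, f (ray R r) = g (ray R r)) -> s < q ->
  (f (left_ray s) <= g (left_ray q))%O.
Proof.
move=> [fT fM fJ] [gT gM gJ] fg sq.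
apply: (@spectrum_compl_le R A _ (f (ray R s))).
  rewrite -fM (fmeetE (opens_glb _ _)).
  have -> : opens_setI (left_ray s) (ray R s) = fjoin (set0 : set (opens R)).
    rewrite (fjoinE (opens_lub _)); apply: oset_inj; apply/seteqP; split => x.
      by move=> [/= h1 h2]; move: (lt_trans h1 h2); rewrite ltxx.
    by move=> [].
  by rewrite fJ image_set0; apply/le_anti; rewrite le0x andbT; apply: (fjoin_le lub).
rewrite fg; have <- : g @` [set ray R s; left_ray q] = [set g (ray R s); g (left_ray q)].
  by rewrite image_setU !image_set1.
rewrite -gJ -gT; congr g; rewrite (fjoinE (opens_lub _)); apply: oset_inj.
apply/seteqP; split => // x _ /=.
have [h|h] := ltP (ratr s) x; first by exists (ray R s) => //; left.
exists (left_ray q); first by right.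
by apply: le_lt_trans h _; rewrite ltr_rat.
Qed.

Lemma rays_determine_le f g : frame_map f -> frame_map g ->
  (forall r, f (ray R r) = g (ray R r)) -> forall U, (f U <= g U)%O.
Proof.
move=> hf hg fg U; have [fT fM fJ] := hf; have [gT gM gJ] := hg.
have left q : (f (left_ray q) <= g (left_ray q))%O.
  have e : left_ray q = fjoin [set left_ray s | s in [set s | s < q]].
    rewrite (fjoinE (opens_lub _)); apply: oset_inj; apply/seteqP; split => x /=.
      move=> /rat_in_itvoo[s]; rewrite in_itv /= => /andP[xs sq].
      by exists (left_ray s) => //; exists s => //=; rewrite -(ltr_rat R).
    by move=> [_ [s /= sq <-] /= xs]; apply: lt_trans xs _; rewrite ltr_rat.
  rewrite {1}e fJ; apply: (fjoin_le lub) => _ [_ [s /= sq <-] <-].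
  exact: frame_map_left_ray.
have e : U = fjoin [set V | (V <= U)%O /\
    exists p q, V = fmeet (ray R p) (left_ray q)].
  rewrite (fjoinE (opens_lub _)); apply: oset_inj; apply/seteqP; split => x /=.
    move=> /opens_ball[d d0 dU].
    have /rat_in_itvoo[p] : x - d < x by rewrite ltrBlDr ltrDl.
    rewrite in_itv /= => /andP[dp px].
    have /rat_in_itvoo[q] : x < x + d by rewrite ltrDl.
    rewrite in_itv /= => /andP[xq qd].
    exists (fmeet (ray R p) (left_ray q)); last by rewrite (fmeetE (opens_glb _ _)); split.
    split; last by exists p, q.
    rewrite (fmeetE (opens_glb _ _)); apply/opens_leP => z [/= pz zq]; apply: dU.
    by rewrite ltr_norml; apply/andP; split; lra.
  by move=> [V [/opens_leP VU _]] /VU.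
rewrite {1}e fJ; apply: (fjoin_le lub) => _ [V [VU [p [q Ve]]] <-].
apply: le_trans (frame_map_mono hg VU); rewrite Ve fM gM; apply: (le_fmeet glb).
  by rewrite -fg; exact: (fmeet_lel glb).
exact: le_trans (fmeet_ler glb _ _) (left q).
Qed.

Lemma rays_determine f g : frame_map f -> frame_map g ->
  (forall r, f (ray R r) = g (ray R r)) -> f = g.
Proof.
move=> hf hg fg; apply/funext => U; apply/le_anti/andP.
by split; apply: rays_determine_le.
Qed.

End RaysDetermine.

Lemma hat_rays_uniq (R : realType) (A : truncType) (a : A)
    (f g : opens R -> spectrum A) : R0 (spec_point A) f -> R0 (spec_point A) g ->
  hat_rays a f -> hat_rays a g -> f = g.
Proof.
move=> [hf _] [hg _] fa ga; apply: rays_determine => // r.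
by apply: spair_inj; rewrite fa ga.
Qed.

Theorem theorem5p1p1 (R : realType) (A : truncType) :
  (forall a : A, 0 <= a ->
     exists! f : opens R -> spectrum A, R0 (spec_point A) f /\ hat_rays a f) /\
  (exists! mu : A -> (opens R -> spectrum A),
     [/\ forall a : A, 0 <= a -> hat_rays a (mu a),
         truncation_morphism (trunc_ops A) (rl_ops R (spectrum A)) mu,
         set_bij [set: A] (range mu) mu,
         range mu `<=` R0 (spec_point A) &
         subtrunc (rl_ops R (spectrum A)) (range mu)]).
Proof.
split.
  move=> a a0; exists (@hat R A a); split.
    by split; [exact: hat_R0|exact: hat_on_rays].
  by move=> f [f0 fa]; apply: (hat_rays_uniq (a := a)) => //; [exact: hat_R0|exact: hat_on_rays].
pose o := rl_ops R (spectrum A).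
have hat0 : @hat R A 0 = op_zero o by exact: hat_const0.
have hat_opp a : @hat R A (- a) = op_opp o (@hat R A a) by apply/funext => U; rewrite hatN.
have nneg (a : A) : op_nneg o (@hat R A a) -> 0 <= a.
  rewrite /op_nneg -hat0 -[op_meet o _ _]/(rl_op Num.min _ _) -hat_meet.
  by move=> /hat_inj e; rewrite -e; exact: lg_meet_ler.
exists (@hat R A); split.
  split.
  - by move=> a a0; exact: hat_on_rays.
  - split => //=.
    + exact: hatD.
    + exact: hat_join.
    + exact: hat_meet.
    + move=> a; rewrite /op_nneg /= => a0; apply: hat_trunc.
      by rewrite -a0; exact: lg_meet_ler.
  - split => [a _|a b _ _|//]; first by exists a.
    exact: hat_inj.
  - by move=> _ [a _ <-]; exact: hat_R0.
  - split.
    + by split; [exists 0|move=> _ [a _ <-]; exists (- a)].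
    + by move=> _ _ [a _ <-] [b _ <-]; exists (a + b) => //; exact: hatD.
    + move=> _ _ [a _ <-] [b _ <-]; split.
        by exists (lg_join a b) => //; exact: hat_join.
      by exists (lg_meet a b) => //; exact: hat_meet.
    + move=> n _ n0 [a _ <-]; have [b ba] := lg_divisible n a n0.
      exists (@hat R A b); first by exists b.
      rewrite -ba; move: n {n0 ba}; elim=> [|n IH]; first by rewrite -hat0.
      by rewrite iterS IH mulrS hatD.
    + move=> _ [a _ <-] /nneg a0; exists (trunc a) => //; exact: hat_trunc.
move=> mu [mu_rays mu_morph _ mu_R0 _]; apply/funext => a.
have [[_ muN] muD _ _ _] := mu_morph.
have pos x : 0 <= x -> @hat R A x = mu x.
  move=> x0; apply: (hat_rays_uniq (a := x)).
  - exact: hat_R0.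
  - by apply: mu_R0; exists x.
  - exact: hat_on_rays.
  - exact: mu_rays.
rewrite -(lg_posBN a) -[mu _]/(mu (op_add (trunc_ops A) _ _)) muD.
rewrite -[mu (- _)]/(mu (op_opp (trunc_ops A) _)) muN.
rewrite -!pos; try exact: lg_pos_ge0.
by rewrite -hat_opp; exact: hatD.
Qed.
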